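(* Let $Y \neq \{0\}$ be a real Banach space with the Daugavet property. Then there exist convex closed bounded symmetric sets $\tilde B_1, \tilde B_2 \subset Y$ which are SCD but whose union $\tilde B_1 \cup \tilde B_2$ is not SCD. If, additionally, $Y$ is separable, then such $\tilde B_1, \tilde B_2$ can be chosen to have non-empty interior.
   Context: All Banach spaces are real. A set $B$ is symmetric if $-B=B$. For a non-empty bounded set $A \subset Y$, a slice of $A$ is a (non-empty) set of the form $S(A,x^*,\varepsilon)=\{x\in A : x^*(x) > \sup_{a\in A} x^*(a)-\varepsilon\}$ with $x^*\in Y^*\setminus\{0\}$ and $\varepsilon>0$. A sequence $(U_n)_{n\in\mathbb N}$ of non-empty subsets of a bounded set $A\subset Y$ is called determining (for $A$) if for every $B\subset Y$ with $B\cap U_n\neq\emptyset$ for all $n$ one has $A\subset\overline{\mathrm{conv}}(B)$ (norm-closed convex hull). A bounded set $A$ is SCD (slicely countably determined) if it has a determining sequence consisting of slices of $A$. A Banach space $Y$ has the Daugavet property if every bounded linear rank-one operator $T\colon Y\to Y$ satisfies $\|I+T\|=1+\|T\|$. *)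

(* Defs.v *)
From HB Require Import structures.
From mathcomp Require Import all_boot all_order all_algebra.
From mathcomp Require Import all_classical all_reals all_analysis.

Set Implicit Arguments.
Unset Strict Implicit.
Unset Printing Implicit Defensive.

Import Order.TTheory GRing.Theory Num.Theory.
Import numFieldNormedType.Exports.

Local Open Scope classical_set_scope.
Local Open Scope ring_scope.

Section Definitions.
Context {R : realType} {Y : normedModType R}.
Implicit Types (A B S : set Y) (U : nat -> set Y).

Definition symmetric_set A := [set - x | x in A] = A.

Definition convex_hull A : set Y := smallest (@convex_set R Y) A.

(* Meant for A nonempty and bounded and xs continuous: otherwise the image of
   A may have no supremum, and [sup] then returns a default value. *)
Definition slice A (xs : Y -> R) (eps : R) : set Y :=
  [set x | A x /\ sup [set xs a | a in A] - eps < xs x].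

Definition is_slice A S :=
  exists (xs : {linear Y -> R^o}) (eps : R),
    [/\ continuous xs, exists y, xs y != 0, 0 < eps & S = slice A xs eps].

Definition determining A U :=
  (forall n, U n !=set0 /\ U n `<=` A) /\
  (forall B, (forall n, B `&` U n !=set0) -> A `<=` closure (convex_hull B)).

(* The set U 0 is a nonempty part of A, so A itself is nonempty. *)
Definition SCD A :=
  bounded_set A /\
  exists U, determining A U /\ forall n, is_slice A (U n).

Definition operator_norm (T : Y -> Y) : R :=
  sup [set `|T x| | x in [set x | `|x| <= 1]].

Definition rank_one (T : Y -> Y) :=
  exists e : Y, e != 0 /\ range T = range (fun c : R => c *: e).

End Definitions.

Definition daugavet_property {R : realType} (Y : normedModType R) :=
  forall T : {linear Y -> Y}, continuous T -> rank_one T ->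
    operator_norm (fun x => x + T x) = 1 + operator_norm T.

Definition separable_space (T : topologicalType) :=
  exists2 D : set T, countable D & dense D.

(* Main.v *)
Require Import Defs.
From HB Require Import structures.
From mathcomp Require Import all_boot all_order all_algebra.
From mathcomp Require Import all_classical all_reals all_analysis.
From mathcomp Require Import ring lra.

Set Implicit Arguments.
Unset Strict Implicit.
Unset Printing Implicit Defensive.

Import Order.TTheory GRing.Theory Num.Theory.
Import numFieldNormedType.Exports.

Local Open Scope classical_set_scope.
Local Open Scope ring_scope.

(** Call a bounded set of vectors isolated when every member u of it has a
    functional f whose value at u exceeds its values at all other members by a
    positive constant. The closed convex hull of a countable isolated symmetric
    set is SCD: the slices of f near u have small diameter, and countably many of
    them determine the hull ([SCD_closed_hull]). The two bodies are of this form.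
    Their union is not SCD because isolation fails in the union of the two sets
    of generators, and it fails badly: every generator z of one body, apart from
    some small ones, is a convex combination e v + (1 - e) (sum of l_j x_j) of
    later generators, where v belongs to the other body only, the x_j belong to
    the body of z, and each of v, x_j is almost l1-orthogonal to everything
    constructed before. A slice of the union that contains z therefore contains
    such a late generator, and descending further, one as late as desired. Given
    any sequence of slices, one picks points x_n in them each of which is almost
    l1-orthogonal to a fixed first generator z0 and to the points picked so far.
    Some functional of norm at most 2 is 1 at z0 and vanishes at the first n
    points, so z0 is not in the closed convex hull of the x_n
    ([union_not_SCD]).

    The construction has to reconcile isolation inside a body with the exact
    convex combination. If f isolates z, then v, which lies outside the body of z,
    absorbs the loss: f v = 4 allows f to be less than 1 at z' = sum of l_j x_j,
    and hence at the x_j as soon as they are weakly close to z'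
    ([add_opposite]). With f v = - 4 instead, the same f becomes, after scaling, a
    functional isolating z' from all the generators of its body; small jointly
    free perturbations then isolate the x_j from each other ([split_last]). All
    the isolating functionals have norm less than 8.

    The Daugavet property supplies the vectors. It gives points almost
    l1-orthogonal to a finite-dimensional subspace in every slice of a ball
    ([daugavet_free]), then in every weak neighbourhood ([free_weakly_dense]),
    and by separation every vector is a convex combination of such points weakly
    close to it ([free_decomposition]). Orthogonality is used only in dual form,
    as the possibility to prescribe the value of a functional at the new vector
    almost without increasing its norm ([free_over]).

    For the interior, both bodies receive additional generators y_k + q_k and
    y_k - q_k of norm at most 5/16 ([add_small_pair]), so that both contain a
    prescribed sequence (y_k) of vectors of norm at most 1/16; in the separable
    case this sequence is dense in the ball of radius 1/16. The bound 8 on the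
    isolating functionals keeps the older generators isolated from them, and they
    do not help to generate z0, because functionals of norm at most 2 are at most
    5/8 at them. *)

(** * Hahn-Banach theorem *)

Section HahnBanach.
Context {R : realType} {V : lmodType R}.
Implicit Types (p q : V -> R).

Definition sublinear p :=
  (forall x y, p (x + y) <= p x + p y) /\
  (forall t x, 0 <= t -> p (t *: x) = t * p x).

Lemma sublinear0 p : sublinear p -> p 0 = 0.
Proof. by move=> [_ /(_ 0 0 (lexx _))]; rewrite scale0r mul0r. Qed.

Lemma sublinear_lower p q x : sublinear q -> (forall x, q x <= p x) ->
  - p (- x) <= q x.
Proof.
move=> qs qp; have := qs.1 x (- x); rewrite subrr sublinear0// => h.
by have := qp (- x); lra.
Qed.

Lemma sublinear_homog p : (forall t x, 0 < t -> p (t *: x) <= t * p x) ->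
  p 0 = 0 -> forall t x, 0 <= t -> p (t *: x) = t * p x.
Proof.
move=> h p0 t x; rewrite le_eqVlt => /predU1P[<-|t0].
  by rewrite scale0r mul0r.
apply/eqP; rewrite eq_le h//=.
have /(_ _) := h t^-1 (t *: x); rewrite invr_gt0 => /(_ t0).
rewrite scalerA mulVf ?gt_eqF// scale1r -(ler_pM2l t0).
by rewrite mulrA mulfV ?gt_eqF// mul1r.
Qed.

(** Zorn's lemma applies because the infimum of a chain of sublinear functions
    is sublinear: of two members of a chain the smaller one bounds the value at
    a sum, and each of them is bounded below by - p (- x). *)
Lemma minimal_sublinear p : sublinear p -> exists q,
  [/\ sublinear q, forall x, q x <= p x &
    forall q', sublinear q' -> (forall x, q' x <= q x) -> forall x, q x <= q' x].
Proof.
move=> ps.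
pose T := {q : V -> R | sublinear q /\ forall x, q x <= p x}.
pose le (s t : T) : bool := `[< forall x, sval t x <= sval s x >].
have p0 : T by exists p.
have [||A Atot|t tmax] := ZL_preorder p0 (R := le).
- by move=> t; apply/asboolP.
- move=> r s t /asboolP rs /asboolP st; apply/asboolP => x.
  exact: le_trans (st x) (rs x).
- have [[a0 Aa0]|A0] := pselect (exists a, A a); last first.
    by exists p0 => s As; exfalso; apply: A0; exists s.
  pose I x := [set sval a x | a in A].
  have Ilb x : has_lbound (I x).
    exists (- p (- x)) => _ [a Aa <-].
    by case: (svalP a) => sa pa; exact: sublinear_lower.
  have I0 x : I x !=set0 by exists (sval a0 x); exists a0.
  pose q x := inf (I x).
  have qle a x : A a -> q x <= sval a x.
    by move=> Aa; apply: ge_inf => //; exists a.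
  have qge x r : (forall a, A a -> r <= sval a x) -> r <= q x.
    by move=> h; apply: lb_le_inf => // _ [a Aa <-]; exact: h.
  have q00 : q 0 = 0.
    apply/eqP; rewrite eq_le; apply/andP; split.
      by have := qle a0 0 Aa0; rewrite (sublinear0 (svalP a0).1).
    by apply: (qge) => a Aa; rewrite (sublinear0 (svalP a).1).
  have qs : sublinear q.
    split.
      move=> x y; rewrite -lerBlDr; apply: (qge) => a Aa.
      rewrite lerBlDr [leRHS]addrC -lerBlDr; apply: (qge) => b Ab.
      rewrite lerBlDr.
      have [/asboolP h|/asboolP h] := Atot a b Aa Ab.
        have := qle b (x + y) Ab; have := (svalP b).1.1 x y.
        by have := h x; lra.
      have := qle a (x + y) Aa; have := (svalP a).1.1 x y.
      by have := h y; lra.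
    apply: sublinear_homog => // t x t0.
    rewrite mulrC -ler_pdivrMr//; apply: (qge) => a Aa.
    rewrite ler_pdivrMr// [leRHS]mulrC -((svalP a).1.2 t x (ltW t0)).
    exact: qle.
  have qp x : q x <= p x.
    exact: le_trans (qle _ _ Aa0) ((svalP a0).2 x).
  by exists (exist _ q (conj qs qp)) => s As; apply/asboolP => x; exact: qle.
- exists (sval t); case: (svalP t) => ts tp; split => // q' q's q'le x.
  have q'p y : q' y <= p y by exact: le_trans (q'le y) (tp y).
  have le_tq' : le t (exist _ q' (conj q's q'p)) by apply/asboolP.
  by have /asboolP := tmax _ le_tq'.
Qed.

(** Linearity as a property of bare functions, so that functionals can be
    combined and chosen without packing them in a structure. *)
Definition lin p := forall a x y, p (a *: x + y) = a * p x + p y.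

(** A minimal sublinear function q is linear: for each a the function
    x |-> inf over t >= 0 of q (x + t a) - t q a is sublinear and below q, hence
    equal to q, and its value at - a shows q (- a) <= - q a. *)
Lemma hahn_banach p : sublinear p ->
  exists f, lin f /\ forall x, f x <= p x.
Proof.
move=> /minimal_sublinear[q [qs qp qmin]]; exists q; split => //.
have qN a : q (- a) = - q a.
  pose I x := [set q (x + t *: a) - t * q a | t in [set t | 0 <= t]].
  have Ilbx x t : 0 <= t -> - q (- x) <= q (x + t *: a) - t * q a.
    move=> t0; rewrite -qs.2//.
    have := qs.1 (x + t *: a) (- x); rewrite addrC addKr; lra.
  have Ilb x : has_lbound (I x).
    by exists (- q (- x)) => _ [t /= t0 <-]; exact: Ilbx.
  have I0 x : I x !=set0 by exists (q (x + 0 *: a) - 0 * q a); exists 0 => /=.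
  pose r x := inf (I x).
  have rle t x : 0 <= t -> r x <= q (x + t *: a) - t * q a.
    by move=> t0; apply: ge_inf => //; exists t.
  have rge x s : (forall t, 0 <= t -> s <= q (x + t *: a) - t * q a) -> s <= r x.
    by move=> h; apply: lb_le_inf => // _ [t /= t0 <-]; exact: h.
  have rq x : r x <= q x.
    by have := rle 0 x (lexx _); rewrite scale0r addr0 mul0r subr0.
  have rs : sublinear r.
    split.
      move=> x y; rewrite -lerBlDr; apply: (rge) => t t0.
      rewrite lerBlDr [leRHS]addrC -lerBlDr; apply: (rge) => s s0.
      rewrite lerBlDr.
      have := rle (t + s) (x + y) (addr_ge0 t0 s0).
      have := qs.1 (x + t *: a) (y + s *: a).
      by rewrite scalerDl [x + y + _]addrACA; lra.
    apply: sublinear_homog => [t x t0|].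
      rewrite mulrC -ler_pdivrMr//; apply: (rge) => s s0.
      rewrite ler_pdivrMr//; have := rle (t * s) (t *: x) (mulr_ge0 (ltW t0) s0).
      by rewrite -scalerA -scalerDr (qs.2 t _ (ltW t0)); lra.
    apply/eqP; rewrite eq_le; apply/andP; split.
      by have := rq 0; rewrite (sublinear0 qs).
    by apply: (rge) => t t0; rewrite add0r qs.2//; lra.
  have := qmin _ rs rq (- a).
  have := rle 1 (- a) ler01; rewrite scale1r addNr mul1r (sublinear0 qs).
  have := qs.1 a (- a); rewrite subrr (sublinear0 qs); lra.
have qD x y : q (x + y) = q x + q y.
  have := qs.1 x y; have := qs.1 (x + y) (- y); rewrite addrK qN; lra.
move=> t x y; rewrite qD; congr (_ + _).
have [t0|t0] := leP 0 t; first exact: qs.2.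
have Nt0 : 0 <= - t by rewrite oppr_ge0 ltW.
by have := qs.2 (- t) x Nt0; rewrite scaleNr qN mulNr => /oppr_inj.
Qed.

Lemma linD p x y : lin p -> p (x + y) = p x + p y.
Proof. by move=> pl; have := pl 1 x y; rewrite scale1r mul1r. Qed.

Lemma lin0 p : lin p -> p 0 = 0.
Proof. by move=> pl; have := linD 0 0 pl; rewrite addr0; lra. Qed.

Lemma linZ p t x : lin p -> p (t *: x) = t * p x.
Proof. by move=> pl; have := pl t x 0; rewrite addr0 lin0// addr0. Qed.

Lemma linN p x : lin p -> p (- x) = - p x.
Proof. by move=> pl; rewrite -scaleN1r linZ// mulN1r. Qed.

Lemma linB p x y : lin p -> p (x - y) = p x - p y.
Proof. by move=> pl; rewrite linD// linN. Qed.

Lemma lin_sum p m (c : nat -> R) (x : nat -> V) : lin p ->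
  p (\sum_(i < m) c i *: x i) = \sum_(i < m) c i * p (x i).
Proof.
move=> pl; elim: m => [|m IH]; first by rewrite !big_ord0 lin0.
by rewrite !big_ord_recr /= linD// linZ// IH.
Qed.

End HahnBanach.

(** * Bounded functionals on a normed space *)

Section Functionals.
Context {R : realType} {Y : normedModType R}.
Implicit Types (f g : Y -> R) (K : set Y) (C : R).

Definition functional C f := lin f /\ forall y, `|f y| <= C * `|y|.

Lemma functional_le C C' f : C <= C' -> functional C f -> functional C' f.
Proof.
by move=> CC' [fl fb]; split => // y; apply: le_trans (fb y) _; rewrite ler_wpM2r.
Qed.

Lemma functional_bound C f y : functional C f -> - (C * `|y|) <= f y <= C * `|y|.
Proof. by move=> [_ /(_ y)]; rewrite ler_norml. Qed.

Lemma functional0 C : 0 <= C -> functional C (fun=> 0 : R).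
Proof.
by move=> C0; split => [a x y|y]; [rewrite mulr0 addr0|rewrite normr0 mulr_ge0].
Qed.

Lemma functional_scale C f t : functional C f ->
  functional (`|t| * C) (fun x => t * f x).
Proof.
move=> [fl fb]; split => [a x y|y]; first by rewrite fl; ring.
by rewrite normrM -mulrA ler_wpM2l.
Qed.

Lemma functional_add C D f g : functional C f -> functional D g ->
  functional (C + D) (fun x => f x + g x).
Proof.
move=> [fl fb] [gl gb]; split => [a x y|y]; first by rewrite fl gl; ring.
by rewrite mulrDl (le_trans (ler_normD _ _))// lerD.
Qed.

Lemma functional_ge0 C f y : functional C f -> f y != 0 -> 0 <= C.
Proof.
move=> [fl fb] fy; have := fb y; have [//|C0] := leP 0 C.
have : 0 < `|f y| by rewrite normr_gt0.
by have := normr_ge0 y; nra.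
Qed.

(** All the extension and separation arguments below reduce to this form of the
    Mazur-Orlicz theorem: finitely or infinitely many constraints f a <= r that
    form a convex cone P can be met by a functional of norm at most C as soon as
    each single constraint can. The functional is obtained below the sublinear
    function y |-> inf of C `|y - a| + r over P. *)
Lemma cone_functional C (P : Y -> R -> Prop) : P 0 0 ->
  (forall a b r s, P a r -> P b s -> P (a + b) (r + s)) ->
  (forall t a r, 0 < t -> P a r -> P (t *: a) (t * r)) ->
  (forall a r, P a r -> - (C * `|a|) <= r) -> 0 <= C ->
  exists f, functional C f /\ forall a r, P a r -> f a <= r.
Proof.
move=> P0 PD PZ PC C0.
pose I y := [set z | exists a r, P a r /\ z = C * `|y - a| + r].
have Ilbx y a r : P a r -> - (C * `|y|) <= C * `|y - a| + r.
  move=> /PC h; have : `|a| <= `|y - a| + `|y|.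
    by have := ler_normB y (y - a); rewrite subKr addrC.
  by move=> /(ler_wpM2l C0); rewrite mulrDr; lra.
have Ilb y : has_lbound (I y).
  by exists (- (C * `|y|)) => _ [a [r [Par ->]]]; exact: Ilbx.
have I0 y : I y !=set0 by exists (C * `|y - 0| + 0), 0, 0.
pose p y := inf (I y).
have ple a r y : P a r -> p y <= C * `|y - a| + r.
  by move=> Par; apply: ge_inf => //; exists a, r.
have pge y s : (forall a r, P a r -> s <= C * `|y - a| + r) -> s <= p y.
  by move=> h; apply: lb_le_inf => // _ [a [r [Par ->]]]; exact: h.
have ps : sublinear p.
  split.
    move=> x y; rewrite -lerBlDr; apply: (pge) => a r Par.
    rewrite lerBlDr [leRHS]addrC -lerBlDr; apply: (pge) => b s Pbs.
    rewrite lerBlDr; apply: le_trans (ple _ _ _ (PD _ _ _ _ Par Pbs)) _.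
    have -> : x + y - (a + b) = (x - a) + (y - b) by rewrite opprD addrACA.
    by have := ler_wpM2l C0 (ler_normD (x - a) (y - b)); rewrite mulrDr; lra.
  apply: sublinear_homog => [t x t0|].
    rewrite mulrC -ler_pdivrMr//; apply: (pge) => a r Par.
    rewrite ler_pdivrMr//; apply: le_trans (ple _ _ _ (PZ _ _ _ t0 Par)) _.
    by rewrite -scalerBr normrZ gtr0_norm//; lra.
  apply/eqP; rewrite eq_le; apply/andP; split.
    by have := ple _ _ 0 P0; rewrite subr0 normr0; lra.
  by apply: (pge) => a r /PC; rewrite sub0r normrN; lra.
have [f [fl fp]] := hahn_banach ps.
have fC y : f y <= C * `|y|.
  by apply: le_trans (fp y) _; have := ple _ _ y P0; rewrite subr0 addr0.
exists f; split.
  split => // y; rewrite ler_norml fC andbT lerNl -linN// -[in leRHS]normrN.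
  exact: fC.
move=> a r Par; apply: le_trans (fp a) _.
by have := ple _ _ a Par; rewrite subrr normr0 mulr0 add0r.
Qed.

Definition cvx K := forall x y (t : R), 0 <= t -> t <= 1 -> K x -> K y ->
  K (t *: x + (1 - t) *: y).

Lemma cvx_convex_set K : cvx K <-> convex_set K.
Proof.
split.
  move=> h x y l /set_mem Kx /set_mem Ky; apply/mem_set.
  exact: h.
move=> h x y t t0 t1 Kx Ky.
have t01 : Itv.spec (@Itv.num_sem R) (Itv.Real `[0%Z, 1%Z]) t.
  by apply/and3P; split; [exact: num_real|rewrite /= bnd_simp|rewrite /= bnd_simp].
exact: set_mem (h x y (Itv.mk t01) (mem_set Kx) (mem_set Ky)).
Qed.

Lemma cvx_cone K a b (t s : R) : cvx K -> 0 < t -> 0 < s -> K a -> K b ->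
  exists2 k, K k & t *: a + s *: b = (t + s) *: k.
Proof.
move=> Kc t0 s0 Ka Kb; exists ((t / (t + s)) *: a + (1 - t / (t + s)) *: b).
  apply: Kc => //; first by rewrite divr_ge0// ?addr_ge0// ltW.
  by rewrite ler_pdivrMr ?addr_gt0// mul1r lerDl ltW.
have ts0 : t + s != 0 by rewrite gt_eqF// addr_gt0.
rewrite scalerDr !scalerA; congr (_ *: _ + _ *: _); by field.
Qed.

(** Strict separation of a point from a convex set, from the constraints
    f (t (k - u)) <= - t d. *)
Lemma separation K u (d : R) : cvx K -> (forall k, K k -> d <= `|u - k|) ->
  exists f, functional 1 f /\ forall k, K k -> f k + d <= f u.
Proof.
move=> Kc Kd; pose P a r := (a = 0 /\ r = 0) \/
  exists t k, [/\ 0 < t, K k, a = t *: (k - u) & r = - (t * d)].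
have [||||//|f [ff fP]] := @cone_functional 1 P.
- by left.
- move=> a b r s [[-> ->]|[t [k [t0 Kk -> ->]]]]; first by rewrite !add0r.
  move=> [[-> ->]|[t' [k' [t'0 Kk' -> ->]]]].
    by rewrite !addr0; right; exists t, k.
  right; have [k2 Kk2 ek2] := cvx_cone Kc t0 t'0 Kk Kk'.
  exists (t + t'), k2; split => //; first exact: addr_gt0.
    by rewrite !scalerBr addrACA ek2 -opprD -scalerDl.
  by ring.
- move=> t a r t0 [[-> ->]|[t' [k' [t'0 Kk' -> ->]]]].
    by left; rewrite scaler0 mulr0.
  right; exists (t * t'), k'; split => //; first exact: mulr_gt0.
    by rewrite scalerA.
  by ring.
- move=> a r [[-> ->]|[t' [k' [t'0 Kk' -> ->]]]]; first by rewrite normr0; lra.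
  by rewrite mul1r lerN2 normrZ gtr0_norm// distrC ler_wpM2l ?Kd// ltW.
exists f; split => // k Kk; have := fP (1 *: (k - u)) (- (1 * d)).
rewrite scale1r mul1r linB; last exact: ff.1.
suff h : P (k - u) (- d) by move=> /(_ h); lra.
by right; exists 1, k; rewrite scale1r mul1r.
Qed.

Lemma norming u : exists f, functional 1 f /\ f u = `|u|.
Proof.
have [x y t _ _ -> ->||f [ff fu]] := @separation [set 0] u `|u|.
- by rewrite !scaler0 addr0.
- by move=> k ->; rewrite subr0.
exists f; split => //; apply/eqP; rewrite eq_le.
have := fu 0 erefl; rewrite lin0 ?add0r; last exact: ff.1.
move=> ->; have := functional_bound u ff; rewrite mul1r.
by move=> /andP[_ ->].
Qed.

End Functionals.

(** * Finite-dimensional subspaces *)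

Section Span.
Context {R : realType} {Y : normedModType R}.
Implicit Types (E : seq Y) (f : Y -> R).

Fixpoint span E (y : Y) : Prop :=
  if E is x :: E' then exists a e, span E' e /\ y = e + a *: x else y = 0.

Lemma span0 E : span E 0.
Proof.
elim: E => //= x E IH; exists 0, 0; split => //.
by rewrite scale0r addr0.
Qed.

Lemma spanD E x y : span E x -> span E y -> span E (x + y).
Proof.
elim: E x y => [x y -> ->|e E IH x y /=]; first by rewrite /= addr0.
move=> [a [u [Eu ->]]] [b [v [Ev ->]]]; exists (a + b), (u + v); split.
  exact: IH.
by rewrite scalerDl addrACA.
Qed.

Lemma spanZ E t x : span E x -> span E (t *: x).
Proof.
elim: E x => [x ->|e E IH x /=]; first by rewrite /= scaler0.
move=> [a [u [Eu ->]]]; exists (t * a), (t *: u); split; first exact: IH.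
by rewrite scalerDr scalerA.
Qed.

Lemma span_mem E x : x \in E -> span E x.
Proof.
elim: E => //= e E IH; rewrite in_cons => /predU1P[->|xE].
  by exists 1, 0; split; [exact: span0|rewrite scale1r add0r].
by exists 0, x; split; [exact: IH|rewrite scale0r addr0].
Qed.

Lemma grid (M tau : R) : 0 < tau -> exists G : seq R,
  forall a, `|a| <= M -> exists2 g, g \in G & `|a - g| < tau.
Proof.
move=> tau0; have [M0|M0] := ltP M 0.
  by exists [::] => a aM; have := normr_ge0 a; lra.
pose h := tau / 2; have h0 : 0 < h by rewrite divr_gt0.
exists [seq - M + i%:R * h | i <- iota 0 (Num.truncn (2 * M / h)).+1] => a.
rewrite ler_norml => /andP[aM1 aM2].
have q0 : 0 <= (a + M) / h by rewrite divr_ge0 ?(ltW h0)//; lra.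
have /andP[] := truncn_itv q0; set n := Num.truncn ((a + M) / h).
rewrite ler_pdivlMr// ltr_pdivrMr// => n1 n2.
exists (- M + n%:R * h).
  apply/mapP; exists n => //; rewrite mem_iota /= add0n ltnS.
  apply: le_truncn; rewrite ler_pdivrMr// divfK ?gt_eqF//; lra.
rewrite ger0_norm; last by lra.
by move: n2; rewrite -natr1 mulrDl mul1r /h; lra.
Qed.

(** Induction on the spanning list. If the new vector x is at positive distance
    from the span of the others, its coefficient is bounded on bounded parts and
    runs over a grid; otherwise x can be approximated by the others, and the net
    for their span already works. *)
Lemma span_totally_bounded E (r kappa : R) : 0 < kappa -> exists N : seq Y,
  forall e, span E e -> `|e| <= r -> exists2 n, n \in N & `|e - n| < kappa.
Proof.
elim: E r kappa => [|x E IH] r k k0.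
  by exists [:: 0] => e -> _; exists 0; rewrite ?mem_seq1// subrr normr0.
have k20 : 0 < k / 2 by rewrite divr_gt0.
have [[d [d0 dE]]|noD] := pselect (exists d, 0 < d /\ forall e, span E e -> d <= `|x + e|).
  have x10 : 0 < 2 * (`|x| + 1) by rewrite mulr_gt0// ltr_wpDl.
  have [G HG] := grid (r / d) (divr_gt0 k0 x10).
  have [N HN] := IH (r + r / d * `|x|) (k / 2) k20.
  exists [seq n + g *: x | n <- N, g <- G] => _ [a [e [Ee ->]]] er.
  have ard : `|a| <= r / d.
    rewrite ler_pdivlMr//; have [->|a0] := eqVneq a 0.
      by rewrite normr0 mul0r (le_trans _ er).
    apply: le_trans er; have -> : e + a *: x = a *: (x + a^-1 *: e).
      by rewrite scalerDr scalerA mulfV// scale1r addrC.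
    by rewrite normrZ ler_wpM2l//; apply: dE; exact: spanZ.
  have [g gG ag] := HG _ ard.
  have er' : `|e| <= r + r / d * `|x|.
    have := ler_normB (e + a *: x) (a *: x); rewrite addrK normrZ.
    have := ler_wpM2r (normr_ge0 x) ard; lra.
  have [n nN en] := HN _ Ee er'.
  exists (n + g *: x); first by apply/allpairsP; exists (n, g).
  have -> : e + a *: x - (n + g *: x) = (e - n) + (a - g) *: x.
    by rewrite opprD addrACA scalerBl.
  have := ler_normD (e - n) ((a - g) *: x); rewrite normrZ.
  have : `|a - g| * `|x| <= k / 2.
    move: ag; rewrite ltr_pdivlMr// => ag.
    have := normr_ge0 (a - g); lra.
  lra.
have [N HN] := IH (r + k / 2) (k / 2) k20.
exists N => _ [a [e [Ee ->]]] er.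
have a10 : 0 < 2 * (`|a| + 1) by rewrite mulr_gt0// ltr_wpDl.
have [e' Ee' xe'] : exists2 e', span E e' & `|x + e'| < k / (2 * (`|a| + 1)).
  apply: contrapT => no; apply: noD; exists (k / (2 * (`|a| + 1))).
  split; first exact: divr_gt0.
  move=> e' Ee'; rewrite leNgt; apply/negP => h; apply: no.
  by exists e'.
have axe : `|a *: (x + e')| <= k / 2.
  move: xe'; rewrite normrZ ltr_pdivlMr// => xe'.
  have := normr_ge0 (x + e'); lra.
have Ee2 : span E (e - a *: e').
  by rewrite -scaleNr; apply: spanD => //; exact: spanZ.
have dec : e + a *: x = (e - a *: e') + a *: (x + e').
  by rewrite scalerDr addrACA addNr addr0.
have er2 : `|e - a *: e'| <= r + k / 2.
  have := ler_normB (e + a *: x) (a *: (x + e')).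
  by rewrite {1}dec addrK; lra.
have [n nN en] := HN _ Ee2 er2.
exists n => //; rewrite dec addrAC.
by apply: le_lt_trans (ler_normD _ _) _; lra.
Qed.

End Span.

(** * Vectors along which functionals can be prescribed *)

Section Free.
Context {R : realType} {Y : normedModType R}.
Implicit Types (E : seq Y) (f g h : Y -> R) (C d : R).

(** The dual form of being almost l1-orthogonal to the span of E: functionals
    known on E may take any value at x that their norm allows, at the cost of a
    factor 1 + d in the norm. In this form the property passes to convex
    combinations and can be iterated. *)
Definition free_over E d x := forall f C t, functional C f -> `|t| <= C ->
  exists f', [/\ functional ((1 + d) * C) f', forall e, e \in E -> f' e = f e &
    f' x = t].

Lemma free_of_norm E d x : 0 <= d ->
  (forall e s, span E e -> `|e| + `|s| <= (1 + d) * `|e + s *: x|) ->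
  free_over E d x.
Proof.
move=> d0 H f C t [fl fb] tC.
have C0 : 0 <= C by exact: le_trans tC.
pose P a r := exists e s, [/\ span E e, a = e + s *: x & r = f e + s * t].
have [|a b r s|t' a r t'0|a r||f' [ff' f'P]] := @cone_functional R Y ((1 + d) * C) P.
- exists 0, 0; split; first exact: span0.
    by rewrite scale0r addr0.
  by rewrite mul0r (lin0 fl) addr0.
- move=> [e [s1 [Ee -> ->]]] [e' [s2 [Ee' -> ->]]].
  exists (e + e'), (s1 + s2); split; first exact: spanD.
    by rewrite scalerDl addrACA.
  by rewrite (linD _ _ fl); ring.
- move=> [e [s1 [Ee -> ->]]]; exists (t' *: e), (t' * s1); split.
  + exact: spanZ.
  + by rewrite scalerDr scalerA.
  + by rewrite (linZ _ _ fl); ring.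
- move=> [e [s1 [Ee -> ->]]].
  have := ler_wpM2l C0 (H e s1 Ee).
  have := fb e; rewrite ler_norml => /andP[f1 _].
  have : `|s1 * t| <= C * `|s1| by rewrite normrM mulrC ler_wpM2r.
  by rewrite ler_norml => /andP[f2 _]; lra.
- by rewrite mulr_ge0// addr_ge0.
have f'E e s : span E e -> f' (e + s *: x) = f e + s * t.
  move=> Ee; apply/eqP; rewrite eq_le f'P/=; last by exists e, s.
  have : f' ((- 1 : R) *: (e + s *: x)) <= - (f e + s * t).
    apply: f'P; exists ((-1 : R) *: e), (- s); split; first exact: spanZ.
      by rewrite scalerDr scalerA mulN1r.
    by rewrite (linZ _ _ fl); ring.
  by rewrite (linZ _ _ ff'.1); lra.
exists f'; split => //.
  move=> e eE; have := f'E e 0 (span_mem eE).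
  by rewrite scale0r addr0 mul0r addr0.
by have := f'E 0 1 (span0 _); rewrite scale1r add0r mul1r (lin0 fl) add0r.
Qed.

Lemma free_subset E E' d x : {subset E' <= E} -> free_over E d x ->
  free_over E' d x.
Proof.
move=> EE' H f C t ff tC; have [f' [ff' f'E f'x]] := H f C t ff tC.
by exists f'; split => // e /EE'; exact: f'E.
Qed.

Lemma free_le E d d' x : d <= d' -> free_over E d x -> free_over E d' x.
Proof.
move=> dd' H f C t ff tC; have [f' [ff' f'E f'x]] := H f C t ff tC.
exists f'; split => //; apply: functional_le ff'.
by rewrite ler_wpM2r ?lerD2l// (le_trans _ tC).
Qed.

Lemma free_scale E d x r : 1 <= r -> free_over E d x -> free_over E d (r *: x).
Proof.
move=> r1 H f C t ff tC; have r0 : 0 < r by exact: lt_le_trans r1.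
have [|f' [ff' f'E f'x]] := H f C (t / r) ff.
  rewrite normrM normfV (gtr0_norm r0) ler_pdivrMr//.
  have C0 : 0 <= C by exact: le_trans tC.
  by apply: le_trans tC _; rewrite ler_peMr.
exists f'; split => //; rewrite linZ; last exact: ff'.1.
by rewrite f'x mulrC divfK// gt_eqF.
Qed.

End Free.

(** * Consequences of the Daugavet property *)

Section Daugavet.
Context {R : realType} {Y : normedModType R}.
Hypothesis Yn0 : exists y : Y, y != 0.
Hypothesis daug : daugavet_property Y.
Implicit Types (E : seq Y) (f g h : Y -> R) (C d : R).

Definition norm_one h := functional 1 h /\
  forall tau, 0 < tau -> exists x, `|x| <= 1 /\ 1 - tau < h x.

Lemma lin_continuous (W : normedModType R) (F : {linear Y -> W}) M :
  (forall x, `|F x| <= M * `|x|) -> continuous F.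
Proof.
move=> FM; apply/linear_bounded_continuous/bounded_funP => r.
exists (`|M| * r) => x xr; apply: le_trans (FM x) _.
apply: le_trans (_ : `|M| * `|x| <= _); first by rewrite ler_wpM2r// ler_norm.
by rewrite ler_wpM2l.
Qed.

Lemma exists_norm (r : R) : 0 <= r -> exists v : Y, `|v| = r.
Proof.
move=> r0; case: Yn0 => y y0; exists ((r / `|y|) *: y).
by rewrite normrZ ger0_norm ?divr_ge0// divfK// normr_eq0.
Qed.

Lemma norm_one_exists : exists h : Y -> R, norm_one h.
Proof.
have [y y1] := exists_norm ler01; have [h [hf hy]] := norming y.
exists h; split => // tau tau0; exists y; rewrite y1 hy y1; split => //; lra.
Qed.

Lemma normalize C h x0 : functional C h -> h x0 != 0 ->
  exists N, [/\ 0 < N, norm_one (fun x => N^-1 * h x) &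
    forall x, h x <= N * `|x|].
Proof.
move=> hf hx0; have C0 := functional_ge0 hf hx0.
pose I := [set h x | x in [set x | `|x| <= 1]].
have Iub : has_ubound I.
  exists C => _ [x /= x1 <-]; have /andP[_] := functional_bound x hf.
  by move=> /le_trans; apply; rewrite ler_piMr.
have I0 : I !=set0 by exists (h 0), 0 => //=; rewrite normr0.
pose N := sup I.
have hN x : h x <= N * `|x|.
  have [->|xn0] := eqVneq x 0; first by rewrite lin0 ?normr0 ?mulr0//; exact: hf.1.
  have nx : 0 < `|x| by rewrite normr_gt0.
  rewrite -ler_pdivrMr//; apply: ub_le_sup => //; exists (`|x|^-1 *: x) => /=.
    by rewrite normrZ normfV normr_id mulVf// gt_eqF.
  by rewrite linZ 1?mulrC//; exact: hf.1.
have hNN x : `|h x| <= N * `|x|.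
  rewrite ler_norml hN andbT lerNl -linN; last exact: hf.1.
  by rewrite -[in leRHS]normrN.
have N0 : 0 < N.
  have : 0 < `|h x0| by rewrite normr_gt0.
  by have := hNN x0; have := normr_ge0 x0; nra.
exists N; split => //; split.
  have hNf : functional N h by split => //; exact: hf.1.
  have := functional_scale N^-1 hNf.
  by rewrite ger0_norm ?invr_ge0 ?(ltW N0)// mulVf// gt_eqF.
move=> tau tau0; have NT : 0 < N * tau by exact: mulr_gt0.
have [_ [x /= x1 <-] xN] := sup_adherent NT (conj I0 Iub).
exists x; split => //; rewrite -(ltr_pM2l N0) mulrA mulfV ?gt_eqF// mul1r.
by rewrite mulrBr mulr1.
Qed.

Section rank_one_map.
Variables (h : Y -> R) (e : Y).
Hypothesis hl : lin h.

Definition rank_one_map (x : Y) : Y := h x *: e.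

Let rank_one_map_linear : linear rank_one_map.
Proof. by move=> a x y; rewrite /rank_one_map hl scalerDl scalerA. Qed.

Definition rank_one_linear : {linear Y -> Y} := HB.pack rank_one_map
  (GRing.isLinear.Build R Y Y _ rank_one_map rank_one_map_linear).

End rank_one_map.

(** The Daugavet equation for x |-> h x e gives x in the ball with
    `|x + h x e| close to 1 + `|e|; up to a sign this forces h x close to 1. *)
Lemma daugavet_slice_point h e (tau : R) : norm_one h -> 0 < tau -> e != 0 ->
  exists x, [/\ `|x| <= 1, 1 - tau < h x & `|e| + 1 - tau < `|x + e|].
Proof.
move=> [hf h1] tau0 e0; have hl := hf.1.
have ne : 0 < `|e| by rewrite normr_gt0.
pose T := rank_one_linear e hl.
have hx1 x : `|x| <= 1 -> `|h x| <= 1.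
  by move=> x1; apply: le_trans (hf.2 x) _; rewrite mul1r.
have Tc : continuous T.
  apply: (@lin_continuous _ T `|e|) => x; rewrite /= /rank_one_map normrZ mulrC.
  by rewrite ler_wpM2l//; have := hf.2 x; rewrite mul1r.
have Tr : rank_one T.
  exists e; split => //; apply/seteqP; split => _ [x _ <-].
    by exists (h x).
  have [x1 [_ hx10]] := h1 1 ltr01.
  have h10 : h x1 != 0 by rewrite gt_eqF//; lra.
  exists ((x / h x1) *: x1) => //=.
  by rewrite /rank_one_map linZ// divfK.
have := daug Tc Tr.
set B := [set x : Y | `|x| <= 1].
have B0 : B 0 by rewrite /B /= normr0.
have opT a : a < `|e| -> a <= operator_norm T.
  move=> ae; have r0 : 0 < 1 - a / `|e|.
    by rewrite subr_gt0 ltr_pdivrMr// mul1r.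
  have [x [x1]] := h1 _ r0; rewrite subKr ltr_pdivrMr// => ahx.
  apply: le_trans (ltW ahx) _; apply: le_trans (_ : `|T x| <= _).
    by rewrite /= /rank_one_map normrZ ler_wpM2r// ler_norm.
  apply: ub_le_sup; last by exists x.
  exists `|e| => _ [z /= z1 <-]; rewrite /rank_one_map normrZ ler_piMl//.
  exact: hx1.
pose I := [set `|x + T x| | x in B].
have HI : has_sup I.
  split; first by exists `|0 + T 0|, 0.
  exists (1 + `|e|) => _ [z /= z1 <-]; apply: le_trans (ler_normD _ _) _.
  by rewrite lerD// /rank_one_map normrZ ler_piMl// hx1.
move=> opI.
pose s := tau / (3 * (1 + `|e|)).
have s0 : 0 < s by rewrite divr_gt0// mulr_gt0// addr_gt0.
have ss : s * (1 + `|e|) = tau / 3.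
  by rewrite /s; field; rewrite gt_eqF// addr_gt0.
pose kap := Num.min (tau / 3) (s * `|e|).
have kap0 : 0 < kap by rewrite lt_min divr_gt0//= mulr_gt0.
have kap1 : kap <= tau / 3 by rewrite ge_min lexx.
have kap2 : kap <= s * `|e| by rewrite ge_min lexx orbT.
have k20 : 0 < kap / 2 by rewrite divr_gt0.
have [_ [x x1 <-]] := sup_adherent k20 HI.
have -> : sup I = 1 + operator_norm T by exact: opI.
have : `|e| - kap / 2 <= operator_norm T by apply: opT; lra.
move=> op1 xk.
have {op1 xk} : 1 + `|e| - kap < `|x + h x *: e|.
  by move: xk; rewrite /= /rank_one_map; lra.
have {x1} x1 : `|x| <= 1 by [].
wlog hx0 : x x1 / 0 <= h x.
  move=> W; have [hx0|hx0 xe] := leP 0 (h x); first exact: W.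
  apply: (W (- x)); first by rewrite normrN.
    by rewrite (linN _ hl) oppr_ge0 ltW.
  by rewrite (linN _ hl) scaleNr -opprD normrN.
move=> xe.
have := ler_normD x (h x *: e); rewrite normrZ ger0_norm// => xe2.
have hxs : 1 - s <= h x.
  have : (1 - s) * `|e| <= h x * `|e| by lra.
  by rewrite ler_pM2r.
have hxle1 : h x <= 1 by apply: le_trans (ler_norm _) (hx1 _ x1).
have st : s <= tau / 3.
  by rewrite -ss ler_peMr ?(ltW s0)//; lra.
exists x; split => //; first by lra.
have : `|(1 - h x) *: e| <= s * `|e|.
  by rewrite normrZ ger0_norm ?ler_wpM2r//; lra.
have := ler_normB (x + e) ((1 - h x) *: e).
have -> : x + e - (1 - h x) *: e = x + h x *: e.
  by rewrite scalerBl scale1r opprB addrA addrAC addrK.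
have : s * (1 + `|e|) = s + s * `|e| by ring.
lra.
Qed.

(** One vector e at a time: if x1 lies in the slice of h and `|x1 + e| is almost
    maximal, add to h a functional y norming x1 + e. Points where h + y is almost
    maximal are almost maximal for both, so they are in the slice of h and almost
    l1-orthogonal to e, and the whole new slice can be refined further. *)
Lemma daugavet_subslice (N : seq Y) h (d : R) : norm_one h -> 0 < d ->
  exists h' d', [/\ norm_one h', 0 < d' &
    forall x, `|x| <= 1 -> 1 - d' < h' x -> 1 - d < h x /\
      forall e, e \in N -> `|e| + 1 - d < `|x + e|].
Proof.
elim: N h d => [|e N IH] h d h1 d0; first by exists h, d; split.
have [h2 [d2 [h21 d20 H]]] := IH h d h1 d0.
have [->|e0] := eqVneq e 0.
  exists h2, d2; split => // x x1 hx; have [hdx HN] := H x x1 hx.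
  split => // e'; rewrite in_cons => /predU1P[->|]; last exact: HN.
  rewrite normr0 addr0 add0r; have := functional_bound x h1.1; rewrite mul1r.
  by move=> /andP[_]; lra.
pose tau := Num.min (Num.min d d2) 1 / 6.
have m0 : 0 < Num.min (Num.min d d2) 1 by rewrite !lt_min d0 d20 ltr01.
have tau0 : 0 < tau by rewrite divr_gt0.
have [t1 [t2 t3]] : tau * 6 <= d /\ (tau * 6 <= d2 /\ tau * 6 <= 1).
  by rewrite /tau divfK// !ge_min !lexx ?orbT.
have [x1 [x11 hx1 ex1]] := daugavet_slice_point h21 tau0 e0.
have [y [yf yx]] := norming (x1 + e).
have yxe : y x1 + y e = `|x1 + e| by rewrite -yx linD//; exact: yf.1.
have ye : y e <= `|e| by have /andP[_] := functional_bound e yf; rewrite mul1r.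
have yx1 : y x1 <= `|x1| by have /andP[_] := functional_bound x1 yf; rewrite mul1r.
have kf := functional_add h21.1 yf.
have kn0 : h2 x1 + y x1 != 0 by rewrite gt_eqF//; lra.
have [n [n0 n1 nb]] := normalize kf kn0.
exists (fun x => n^-1 * (h2 x + y x)), tau; split => // x x1' kx.
have nx1 := nb x1.
have n2 : 2 - 2 * tau < n.
  have : n * `|x1| <= n by rewrite ler_piMr// ltW.
  lra.
have hyx : 2 - 4 * tau < h2 x + y x.
  move: kx; rewrite -(ltr_pM2l n0) mulrA mulfV ?gt_eqF// mul1r => kx.
  have : (2 - 2 * tau) * (1 - tau) <= n * (1 - tau) by rewrite ler_pM2r; lra.
  have : 0 < tau * tau by exact: mulr_gt0.
  lra.
have h2x : h2 x <= 1.
  by have /andP[_] := functional_bound x h21.1; lra.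
have yx' : y x <= 1.
  by have /andP[_] := functional_bound x yf; lra.
have [|hdx HN] := H x x1'; first by lra.
split => // e'; rewrite in_cons => /predU1P[->|]; last exact: HN.
have /andP[_] := functional_bound (x + e) yf.
rewrite linD; last exact: yf.1.
lra.
Qed.

(** Almost l1-orthogonality to a finite net of the span of E extends to the
    whole span; vectors of large norm satisfy it automatically. The free point is
    found in a prescribed slice of the ball of radius rho. *)
Lemma daugavet_free E d h C z (rho eta : R) : 0 < d -> functional C h ->
  1 <= rho -> `|z| <= rho -> 0 < eta ->
  exists x, [/\ `|x| <= rho, free_over E d x & h z - eta < h x].
Proof.
move=> d0 hf rho1 zrho eta0; have rho0 : 0 < rho by lra.
have main h1 e : norm_one h1 -> 0 < e ->
    exists x, [/\ `|x| <= 1, free_over E d x & 1 - e < h1 x].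
  move=> h11 e0.
  have [k k0 kd] : exists2 k, 0 < k & forall r : R, 0 <= r -> r + 1 <= (1 + d) * (r + 1 - k).
    exists (d / (1 + d)); first by rewrite divr_gt0//; lra.
    move=> r r0; have -> : (1 + d) * (r + 1 - d / (1 + d)) = (1 + d) * (r + 1) - d.
      by field; rewrite gt_eqF//; lra.
    by have := mulr_ge0 (ltW d0) r0; lra.
  pose M := (2 + d) / d.
  have Md : M * d = 2 + d by rewrite divfK// gt_eqF.
  have k30 : 0 < k / 3 by rewrite divr_gt0.
  have [N HN] := span_totally_bounded E M k30.
  have mk0 : 0 < Num.min e (k / 3) by rewrite lt_min e0.
  have [h2 [d2 [h21 d20 H]]] := daugavet_subslice N h11 mk0.
  have [x [x1 h2x]] := h21.2 _ d20.
  have [h1x xN] := H x x1 h2x; exists x; split => //; last first.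
    apply: le_lt_trans h1x; rewrite lerD2l lerN2; by rewrite ge_min lexx.
  apply: free_of_norm; first exact: ltW.
  have E1 v : span E v -> `|v| + 1 <= (1 + d) * `|v + x|.
    move=> Ev; have [vM|Mv] := leP `|v| M.
      have [n nN vn] := HN v Ev vM.
      have := xN n nN; have : Num.min e (k / 3) <= k / 3 by rewrite ge_min lexx orbT.
      have := ler_normB (v + x) (v - n).
      have -> : v + x - (v - n) = x + n.
        by rewrite opprB [v + x]addrC addrACA subrr addr0.
      move=> a1 a2 a3.
      have := ler_normD (v - n) n; rewrite subrK => a4.
      apply: le_trans (kd _ (normr_ge0 v)) _.
      by rewrite ler_pM2l; lra.
    have := ler_normB (v + x) x; rewrite addrK => a1.
    have : (1 + d) * (`|v| - 1) <= (1 + d) * `|v + x| by rewrite ler_pM2l; lra.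
    have : M * d < `|v| * d by rewrite ltr_pM2r.
    lra.
  move=> v s Ev; have [->|s0] := eqVneq s 0.
    rewrite normr0 addr0 scale0r addr0; have := mulr_ge0 (ltW d0) (normr_ge0 v).
    lra.
  have -> : v + s *: x = s *: (s^-1 *: v + x).
    by rewrite scalerDr scalerA mulfV// scale1r.
  have ns : 0 < `|s| by rewrite normr_gt0.
  have := E1 _ (spanZ s^-1 Ev).
  rewrite -(ler_pM2l ns) mulrDr mulr1 normrZ mulrA -normrM mulfV// normr1 mul1r.
  by move=> H1; rewrite normrZ; lra.
have [[x0 hx0]|h0] := pselect (exists x0, h x0 != 0).
  have [n [n0 n1 nb]] := normalize hf hx0.
  have e0 : 0 < eta / (rho * n) by rewrite divr_gt0// mulr_gt0.
  have [x [x1 xf hx]] := main _ _ n1 e0.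
  exists (rho *: x); split.
  - by rewrite normrZ ger0_norm ?(ltW rho0)// ler_piMr// ltW.
  - exact: free_scale.
  - rewrite linZ; last exact: hf.1.
    have rn0 : 0 < rho * n by exact: mulr_gt0.
    move: hx; rewrite -(ltr_pM2l rn0) mulrBr mulr1 [rho * n * (eta / _)]mulrC.
    rewrite divfK ?gt_eqF// mulrA mulfK ?gt_eqF//.
    have := nb z; have : n * `|z| <= n * rho by rewrite ler_pM2l.
    lra.
have hz y : h y = 0.
  by apply/eqP; apply/negP => /negP hy; apply: h0; exists y.
have [h1 h11] := norm_one_exists.
have [x [x1 xf hx]] := main _ _ h11 ltr01.
exists (rho *: x); split.
- by rewrite normrZ ger0_norm ?(ltW rho0)// ler_piMr// ltW.
- exact: free_scale.
- by rewrite !hz; lra.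
Qed.

End Daugavet.

(** * Free points in weak neighbourhoods and decompositions *)

Section Flexibility.
Context {R : realType} {Y : normedModType R}.
Implicit Types (E : seq Y) (f g h : Y -> R) (C d : R).

Lemma square_tolerance d : 0 < d -> exists d1,
  [/\ 0 < d1, d1 <= 1 / 4, d1 <= d & (1 + d1) * (1 + d1) <= 1 + d].
Proof.
move=> d0; pose d1 := Num.min d 1 / 4.
have m0 : 0 < Num.min d 1 by rewrite lt_min d0 ltr01.
have d10 : 0 < d1 by rewrite divr_gt0.
have [dd1 d1le] : d1 * 4 <= d /\ d1 * 4 <= 1.
  by rewrite /d1 divfK// !ge_min !lexx orbT.
have d11 : d1 * d1 <= d1 * (1 / 4) by rewrite ler_pM2l//; lra.
exists d1; split => //; lra.
Qed.

(** Prescribe the value s first at x1, then at x2. *)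
Lemma free_convex E d d' x1 x2 (t : R) : 0 <= d -> (1 + d) * (1 + d) <= 1 + d' ->
  free_over E d x1 -> free_over (x1 :: E) d x2 ->
  free_over E d' (t *: x1 + (1 - t) *: x2).
Proof.
move=> d0 dd' F1 F2 f C s ff sC; have C0 : 0 <= C by exact: le_trans sC.
have [f1 [f1f f1E f1x]] := F1 f C s ff sC.
have sC1 : `|s| <= (1 + d) * C by apply: le_trans sC _; rewrite ler_peMl//; lra.
have [f2 [f2f f2E f2x]] := F2 f1 _ s f1f sC1.
exists f2; split.
- by apply: functional_le f2f; rewrite mulrA ler_wpM2r.
- by move=> e eE; rewrite f2E ?in_cons ?eE ?orbT// f1E.
- rewrite (linD _ _ f2f.1) !(linZ _ _ f2f.1) f2x f2E ?mem_head// f1x; ring.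
Qed.

(** A functional that is 0 on E and 1 at x corrects the value at x'. *)
Lemma free_perturb E d d' x x' (s : R) : 0 <= d -> 0 <= s ->
  (1 + d) * s <= 1 / 2 -> (1 + d) * (1 + 2 * ((1 + d) * s)) <= 1 + d' ->
  `|x' - x| <= s -> free_over E d x -> free_over E d' x'.
Proof.
move=> d0 s0 q2 dd' xs F f C t ff tC; have C0 : 0 <= C by exact: le_trans tC.
set q := (1 + d) * s in q2 dd'.
have q0 : 0 <= q by rewrite mulr_ge0// addr_ge0.
have [f1 [f1f f1E f1x]] := F f C t ff tC.
have [|phi [phif phiE phix]] := F _ 1 1 (functional0 ler01); first by rewrite normr1.
have phie : `|phi (x' - x)| <= q.
  by apply: le_trans (phif.2 _) _; rewrite mulr1 ler_wpM2l//; lra.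
have f1e : `|f1 (x' - x)| <= q * C.
  apply: le_trans (f1f.2 _) _; have d1 : 0 <= 1 + d by lra.
  have := ler_wpM2l (mulr_ge0 d1 C0) xs; rewrite /q; lra.
have phix' : phi x' = 1 + phi (x' - x) by rewrite (linB _ _ phif.1) phix; lra.
have f1x' : f1 x' = t + f1 (x' - x) by rewrite (linB _ _ f1f.1) f1x; lra.
move: (phie); rewrite ler_norml => /andP[phie1 phie2].
have phi2 : 1 / 2 <= phi x' by lra.
have phi0 : 0 < phi x' by lra.
pose c := (t - f1 x') / phi x'.
have cC : `|c| <= 2 * (q * C).
  rewrite /c normrM normfV (gtr0_norm phi0) ler_pdivrMr// f1x' opprD addrA subrr.
  rewrite add0r normrN; apply: le_trans f1e _.
  by have := mulr_ge0 q0 C0; nra.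
exists (fun y => f1 y + c * phi y); split.
- apply: functional_le (functional_add f1f (functional_scale c phif)).
  have : `|c| * ((1 + d) * 1) <= 2 * (q * C) * ((1 + d) * 1).
    by rewrite ler_wpM2r// mulr1; lra.
  have := ler_wpM2r C0 dd'; lra.
- by move=> e eE; rewrite phiE// mulr0 addr0 f1E.
- by rewrite /c divfK ?gt_eqF//; lra.
Qed.

Lemma free_nearby d' : 0 < d' -> exists d s, [/\ 0 < d, 0 < s &
  forall E x x', `|x' - x| <= s -> free_over E d x -> free_over E d' x'].
Proof.
move=> d'0; pose d := Num.min d' 1 / 4.
have m0 : 0 < Num.min d' 1 by rewrite lt_min d'0 ltr01.
have d0 : 0 < d by rewrite divr_gt0.
have [dd d1] : d * 4 <= d' /\ d * 4 <= 1.
  by rewrite /d divfK// !ge_min !lexx orbT.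
exists d, (d / 8); split => //; first by rewrite divr_gt0.
have dd2 : d * d <= d * (1 / 4) by rewrite ler_pM2l//; lra.
have ddd : d * (d * d) <= d * (1 / 4) by rewrite ler_pM2l//; lra.
move=> E x x' xx'; apply: (free_perturb _ _ _ _ xx'); lra.
Qed.

Hypothesis Yn0 : exists y : Y, y != 0.
Hypothesis daug : daugavet_property Y.

Lemma free_exists E d : 0 < d -> exists x, `|x| <= 1 /\ free_over E d x.
Proof.
move=> d0.
have [|x [x1 xf _]] := daugavet_free Yn0 daug E d0 (functional0 ler01) (lexx 1) _ ltr01 (z := 0).
  by rewrite normr0.
by exists x.
Qed.

Lemma free_family m E d : 0 < d -> exists p : nat -> Y,
  (forall i, (i < m)%N -> `|p i| <= 1) /\
  forall f C (t : nat -> R), functional C f -> 0 <= C ->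
    (forall i, (i < m)%N -> `|t i| <= C) ->
  exists f', [/\ functional ((1 + d) * C) f', forall e, e \in E -> f' e = f e &
    forall i, (i < m)%N -> f' (p i) = t i].
Proof.
elim: m E d => [|m IH] E d d0.
  exists (fun=> 0); split => // f C t ff C0 _; exists f; split => //.
  by apply: functional_le ff; rewrite ler_peMl//; lra.
have [d1 [d10 d14 dd1 d1d]] := square_tolerance d0.
have [p [p1 pF]] := IH E _ d10.
have [x [x1 xF]] := free_exists (E ++ [seq p i | i <- iota 0 m]) d10.
exists (fun i => if i == m then x else p i); split.
  move=> i; rewrite ltnS leq_eqVlt; case: eqP => //= _; exact: p1.
move=> f C t ff C0 tC.
have [|f1 [f1f f1E f1p]] := pF f C t ff C0.
  by move=> i im; apply: tC; exact: ltnW.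
have C1 : C <= (1 + d1) * C by rewrite ler_peMl//; lra.
have [|f2 [f2f f2E f2x]] := xF f1 _ (t m) f1f; first by apply: le_trans C1; exact: tC.
exists f2; split.
- by apply: functional_le f2f; rewrite mulrA ler_wpM2r.
- by move=> e eE; rewrite f2E ?mem_cat ?eE// f1E.
- move=> i; rewrite ltnS leq_eqVlt; case: eqP => [->//|_ /= im].
  rewrite f2E ?f1p// mem_cat; apply/orP; right; apply/mapP; exists i => //.
  by rewrite mem_iota.
Qed.

(** Shvydkoy's theorem: free points exist not only in slices but in all weak
    neighbourhoods. Induction on the number of functionals. To fix the value of
    the last one, g, while keeping h large, apply the induction hypothesis to
    h + mu g for mu in a fine grid of a long interval: for mu at the left end g
    is small, at the right end it is large, so between two neighbouring values
    of mu the sign of g x - g z may change, and a convex combination of the two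
    corresponding points does what is wanted. It is free if the second point is
    chosen free over the first one as well. *)
Lemma free_weakly_dense n (G : nat -> Y -> R) C E h C' d z (rho eta : R) :
  (forall i, (i < n)%N -> functional C (G i)) -> functional C' h ->
  0 < d -> 1 <= rho -> `|z| <= rho -> 0 < eta ->
  exists x, [/\ `|x| <= rho, free_over E d x, h z - eta < h x &
    forall i, (i < n)%N -> `|G i x - G i z| < eta].
Proof.
elim: n E h C' d eta => [|n IH] E h C' d eta GC hC d0 rho1 zrho eta0.
  have [x [x1 xF hx]] := daugavet_free Yn0 daug E d0 hC rho1 zrho eta0.
  by exists x.
have GC' i : (i < n)%N -> functional C (G i) by move=> /ltnW; exact: GC.
set g := G n; have gC : functional C g by exact: GC.
have gl := gC.1; have hl := hC.1.
pose M := `|2 * rho * C| + 1; pose M' := `|2 * rho * C'| + 1.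
have M0 : 0 < M by rewrite ltr_wpDl.
have M'0 : 0 < M' by rewrite ltr_wpDl.
have bnd (D : R) k x : functional D k -> `|x| <= rho -> `|k x - k z| <= `|2 * rho * D| + 1.
  move=> kD xr; rewrite -linB; last exact: kD.1.
  apply: le_trans (kD.2 _) _.
  apply: le_trans (_ : `|D| * (2 * rho) <= _); last first.
    rewrite [2 * rho * D]mulrC normrM [`|2 * rho|]ger0_norm; lra.
  apply: le_trans (ler_wpM2r (normr_ge0 _) (ler_norm D)) _.
  rewrite ler_wpM2l//; have := ler_normB x z; lra.
have [d1 [d10 _ dd1 d1d]] := square_tolerance d0.
pose L := 2 * (M' + eta) / eta.
have Leta : L * eta = 2 * (M' + eta) by rewrite /L divfK// gt_eqF.
have L0 : 0 < L by rewrite divr_gt0// mulr_gt0// addr_gt0.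
pose kap := eta / (4 * M).
have kap0 : 0 < kap by rewrite divr_gt0// mulr_gt0.
have kapM : kap * M = eta / 4 by rewrite /kap; field; rewrite gt_eqF.
pose mu k := - L + k%:R * kap.
pose K := (Num.truncn (2 * L / kap)).+1.
have muK : L <= mu K.
  have q0 : 0 <= 2 * L / kap by rewrite divr_ge0// ?ltW//; lra.
  have /andP[_] := truncn_itv q0; rewrite ltr_pdivrMr// -/K => h1.
  by rewrite /mu; lra.
pose a x := g x - g z; pose b x := h x - h z.
pose ok k E' x := [/\ `|x| <= rho, free_over E' d1 x, - (eta / 4) < b x + mu k * a x &
  forall i, (i < n)%N -> `|G i x - G i z| < eta].
have okE k E' : exists x, ok k E' x.
  have hk := functional_add hC (functional_scale (mu k) gC).
  have e40 : 0 < eta / 4 by rewrite divr_gt0.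
  have [x [x1 xF hx Gx]] := IH E' _ _ d1 (eta / 4) GC' hk d10 rho1 zrho e40.
  exists x; split => //; first by rewrite /a /b; lra.
  by move=> i im; apply: lt_le_trans (Gx i im) _; lra.
have wk k x E' : ok k E' x -> `|a x| <= M /\ `|b x| <= M'.
  by move=> [x1 _ _ _]; split; exact: bnd.
(* quantifying over all E' lets the two points be chosen one after the other *)
pose neg k := forall E', exists x, ok k E' x /\ a x <= 0.
have posN k : ~ neg k -> forall E', exists x, ok k E' x /\ 0 <= a x.
  move=> /existsNP[E1 HE1] E'.
  have [x xok] := okE k (E1 ++ E').
  have sub E2 : {subset E2 <= E1 ++ E'} -> ok k E2 x.
    by move=> E2s; case: xok => ? xF ? ?; split => //; exact: free_subset xF.
  exists x; split.
    by apply: sub => e eE; rewrite mem_cat eE orbT.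
  rewrite leNgt; apply/negP => ax; apply: HE1; exists x; split; last exact: ltW.
  by apply: sub => e eE; rewrite mem_cat eE.
have fd x : free_over E d1 x -> free_over E d x by apply: free_le; lra.
have fin x : `|x| <= rho -> free_over E d x -> - eta < b x -> `|a x| < eta ->
    (forall i, (i < n)%N -> `|G i x - G i z| < eta) ->
    exists x, [/\ `|x| <= rho, free_over E d x, h z - eta < h x &
      forall i, (i < n.+1)%N -> `|G i x - G i z| < eta].
  move=> x1 xF bx ax Gx; exists x; split => //; first by move: bx; rewrite /b; lra.
  by move=> i; rewrite ltnS leq_eqVlt => /predU1P[->//|]; exact: Gx.
have [n0|/posN/(_ E)[x [xok ax]]] := pselect (neg 0%N); last first.
  have [axM bxM] := wk _ _ _ xok; case: xok => x1 xF xb xG.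
  move: bxM; rewrite ler_norml => /andP[_ bM].
  move: xb; rewrite /mu mul0r addr0 => xb.
  apply: (fin x) => //; first exact: fd.
    by have := mulr_ge0 (ltW L0) ax; lra.
  rewrite ger0_norm// -(ltr_pM2l L0) Leta; lra.
have [/(_ E)[x [xok ax]]|nK] := pselect (neg K).
  have [axM bxM] := wk _ _ _ xok; case: xok => x1 xF xb xG.
  move: bxM; rewrite ler_norml => /andP[_ bM].
  have muax : mu K * a x <= L * a x by rewrite ler_wnM2r.
  apply: (fin x) => //; first exact: fd.
    have : L * a x <= 0 by rewrite mulr_ge0_le0// ltW.
    lra.
  by rewrite ler0_norm// -(ltr_pM2l L0) Leta; lra.
have [k [nk npk]] : exists k, neg k /\ ~ neg k.+1.
  apply: contrapT => no; apply: nK.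
  elim: K {muK} => // k IHk; apply: contrapT => h1; apply: no.
  by exists k.
have [x1 [x1ok ax1]] := nk E.
have [x2 [x2ok ax2]] := posN _ npk (x1 :: E).
have [axM2 _] := wk _ _ _ x2ok.
case: x1ok => x11 x1F x1b x1G; case: x2ok => x21 x2F x2b x2G.
have [t [t0 t1 tz]] : exists t, [/\ 0 <= t, t <= 1 & t * a x1 + (1 - t) * a x2 = 0].
  have [ds|ds] := ltP 0 (a x2 - a x1).
    exists (a x2 / (a x2 - a x1)); split.
    - by rewrite divr_ge0// ltW.
    - by rewrite ler_pdivrMr//; lra.
    - by field; rewrite gt_eqF.
  by exists 1; split => //; lra.
have t10 : 0 <= 1 - t by lra.
have aff k' D : functional D k' ->
    k' (t *: x1 + (1 - t) *: x2) - k' z = t * (k' x1 - k' z) + (1 - t) * (k' x2 - k' z).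
  by move=> kD; rewrite (linD _ _ kD.1) !(linZ _ _ kD.1); ring.
apply: (fin (t *: x1 + (1 - t) *: x2)).
- apply: le_trans (ler_normD _ _) _; rewrite !normrZ !ger0_norm//.
  by have := ler_wpM2l t0 x11; have := ler_wpM2l t10 x21; lra.
- by apply: free_convex d1d x1F x2F; exact: ltW.
- rewrite /b (aff _ _ hC) -/(b x1) -/(b x2).
  have h1 := ler_wpM2l t0 (ltW x1b).
  have h2 := ler_wpM2l t10 (ltW x2b).
  have h3 : (1 - t) * (kap * a x2) <= eta / 4.
    have h4 : kap * a x2 <= eta / 4.
      by rewrite -kapM ler_pM2l//; exact: le_trans (ler_norm _) axM2.
    by have := ler_wpM2l t10 h4; have := mulr_ge0 t0 (ltW eta0); lra.
  have mus : mu k.+1 = mu k + kap by rewrite /mu -natr1; lra.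
  have h5 : mu k * (t * a x1 + (1 - t) * a x2) = 0 by rewrite tz mulr0.
  move: h2; rewrite mus => h2; lra.
- by rewrite /a (aff _ _ gC) -/(a x1) -/(a x2) tz normr0.
- move=> i im; rewrite (aff _ _ (GC' i im)).
  apply: le_lt_trans (ler_normD _ _) _; rewrite !normrM !(ger0_norm t0) (ger0_norm t10).
  have := x1G i im; have := x2G i im.
  move: (`|G i x1 - G i z|) (`|G i x2 - G i z|) => r1 r2 h2 h1.
  have := ler_wpM2l t10 (ltW h2); have := ler_wpM2l t0 (ltW h1).
  have [->|tn0] := eqVneq t 0; first lra.
  have tp : 0 < t by rewrite lt_neqAle eq_sym tn0.
  have : t * r1 < t * eta by rewrite ltr_pM2l.
  lra.
Qed.

Definition combination (X : set Y) (y : Y) := exists s : seq (R * Y),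
  [/\ forall p, p \in s -> 0 <= p.1 /\ X p.2, \sum_(p <- s) p.1 = 1 &
    y = \sum_(p <- s) p.1 *: p.2].

Lemma sub_combination X : X `<=` combination X.
Proof.
move=> x Xx; exists [:: (1, x)]; split.
- by move=> p; rewrite mem_seq1 => /eqP ->.
- by rewrite big_seq1.
- by rewrite big_seq1 scale1r.
Qed.

Lemma cvx_combination X : cvx (combination X).
Proof.
move=> x y t t0 t1 [s [sX s1 ->]] [s' [s'X s'1 ->]].
exists ([seq (t * p.1, p.2) | p <- s] ++ [seq ((1 - t) * p.1, p.2) | p <- s']).
split.
- move=> p; rewrite mem_cat => /orP[] /mapP[q qs ->] /=.
    by have [q1 q2] := sX q qs; rewrite mulr_ge0.
  by have [q1 q2] := s'X q qs; rewrite mulr_ge0//; lra.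
- rewrite big_cat !big_map /= -!mulr_sumr s1 s'1; ring.
- rewrite big_cat !big_map /= !scaler_sumr; congr (_ + _);
    by apply: eq_bigr => i _; rewrite scalerA.
Qed.

(** By separation, z is a limit of convex combinations of free points weakly
    close to z: a functional separating it from them would be one more weak
    constraint. Translating all the points by the small remaining error makes
    the combination exact. *)
Lemma free_decomposition n (G : nat -> Y -> R) C E d z (rho eta : R) :
  (forall i, (i < n)%N -> functional C (G i)) ->
  0 < d -> 1 <= rho -> `|z| <= rho -> 0 < eta ->
  combination [set x | [/\ `|x| <= rho + eta, free_over E d x &
    forall i, (i < n)%N -> `|G i x - G i z| < eta]] z.
Proof.
move=> GC d0 rho1 zrho eta0.
have [d1 [s [d10 s0 near]]] := free_nearby d0.
pose C1 := `|C| + 1; have C10 : 0 < C1 by rewrite ltr_wpDl.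
pose e := Num.min (Num.min s eta) (eta / (2 * C1)).
have e0 : 0 < e by rewrite !lt_min s0 eta0 divr_gt0// mulr_gt0.
have [es [eeta eC]] : e <= s /\ (e <= eta /\ e <= eta / (2 * C1)).
  by rewrite /e !ge_min !lexx ?orbT.
pose X := [set x : Y | [/\ `|x| <= rho, free_over E d1 x &
  forall i, (i < n)%N -> `|G i x - G i z| < eta / 2]].
have [k [[t [tX t1 kE]] kz]] : exists k, combination X k /\ `|z - k| < e.
  apply: contrapT => no.
  have [|f [ff fX]] := separation (u := z) (d := e) (@cvx_combination X).
    move=> k Xk; rewrite leNgt; apply/negP => h; apply: no; by exists k.
  have e20 : 0 < Num.min e (eta / 2) by rewrite lt_min e0 divr_gt0.
  have [x [x1 xF fx xG]] := free_weakly_dense E GC ff d10 rho1 zrho e20.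
  have Xx : X x.
    split => // i im; apply: lt_le_trans (xG i im) _.
    by rewrite ge_min lexx orbT.
  have := fX x (sub_combination Xx).
  have : Num.min e (eta / 2) <= e by rewrite ge_min lexx.
  lra.
pose v := z - k.
exists [seq (p.1, p.2 + v) | p <- t]; split.
- move=> p /mapP[q qt ->] /=; have [q0 [q1 qF qG]] := tX q qt; split => //; split.
  + by apply: le_trans (ler_normD _ _) _; rewrite lerD// ltW// (lt_le_trans kz).
  + by apply: near qF; rewrite addrC addKr ltW// (lt_le_trans kz).
  + move=> i im; have Gi := GC i im; rewrite (linD _ _ Gi.1).
    have : `|G i v| <= eta / 2.
      apply: le_trans (Gi.2 v) _; apply: le_trans (_ : C1 * `|v| <= _).
        by rewrite ler_wpM2r//; have := ler_norm C; rewrite /C1; lra.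
      have : C1 * `|v| <= C1 * (eta / (2 * C1)).
        by rewrite ler_pM2l// (le_trans (ltW kz)).
      have -> : C1 * (eta / (2 * C1)) = eta / 2 by field; rewrite gt_eqF.
      done.
    have := qG i im; rewrite addrAC => a1 a2.
    by apply: le_lt_trans (ler_normD _ _) _; lra.
- by rewrite big_map.
- rewrite big_map /=; under eq_bigr do rewrite scalerDr.
  by rewrite big_split /= -kE -scaler_suml t1 scale1r /v addrCA subrr addr0.
Qed.

(** The points of a free decomposition may be close to each other for every
    functional at hand. Small multiples of vectors p_j that are jointly free,
    recentred so that the barycentre does not move, make it possible to push the
    value at each x_j up or down independently. *)
Lemma spread_decomposition n (G : nat -> Y -> R) C E d d' z (rho tau : R) :
  (forall i, (i < n)%N -> functional C (G i)) -> 0 <= C ->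
  0 < d -> 0 < d' -> 1 <= rho -> `|z| <= rho -> 0 < tau ->
  exists m (lam : nat -> R) (x : nat -> Y) sigma, [/\ 0 < sigma <= tau,
    (forall j, (j < m)%N -> 0 <= lam j) /\ \sum_(j < m) lam j = 1,
    z = \sum_(j < m) lam j *: x j,
    forall j, (j < m)%N -> `|x j| <= rho + 3 * sigma /\ free_over E d (x j) &
    forall i (u : nat -> R), (i < n)%N -> (forall j, (j < m)%N -> `|u j| <= C) ->
      exists f, [/\ functional ((1 + d') * C) f, forall e, e \in E -> f e = G i e &
        forall j, (j < m)%N -> `|f (x j) -
          (G i z + sigma * (u j - \sum_(l < m) lam l * u l))| < sigma / 4]].
Proof.
move=> GC C0 d0 d'0 rho1 zrho tau0.
have [d1 [s [d10 s0 near]]] := free_nearby d0.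
pose sigma := Num.min tau (s / 2).
have sg0 : 0 < sigma by rewrite lt_min tau0 divr_gt0.
have [st ss] : sigma <= tau /\ sigma <= s / 2 by rewrite !ge_min !lexx orbT.
have eta0 : 0 < sigma / 4 by rewrite divr_gt0.
have [t [tX tsum zE]] := free_decomposition E GC d10 rho1 zrho eta0.
set m := size t.
pose lam j := (nth (0, 0) t j).1; pose x j := (nth (0, 0) t j).2.
have tj j : (j < m)%N -> nth (0, 0) t j \in t by exact: mem_nth.
have lam0 j : (j < m)%N -> 0 <= lam j by move=> /tj/tX[].
have lam1 : \sum_(j < m) lam j = 1 by rewrite -tsum (big_nth (0, 0)) big_mkord.
have zx : z = \sum_(j < m) lam j *: x j by rewrite {1}zE (big_nth (0, 0)) big_mkord.
have xP j : (j < m)%N -> [/\ `|x j| <= rho + sigma / 4, free_over E d1 (x j) &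
  forall i, (i < n)%N -> `|G i (x j) - G i z| < sigma / 4] by move=> /tj/tX[].
have [p [p1 pF]] := free_family m (E ++ [seq x j | j <- iota 0 m]) d'0.
pose pm := \sum_(j < m) lam j *: p j.
have pm1 : `|pm| <= 1.
  apply: le_trans (ler_norm_sum _ _ _) _; rewrite -lam1; apply: ler_sum => j _.
  by rewrite normrZ ger0_norm ?lam0// ler_piMr ?lam0// p1.
pose x' j := x j + sigma *: (p j - pm).
have x'x j : (j < m)%N -> `|x' j - x j| <= sigma * 2.
  move=> jm; rewrite addrC addKr normrZ gtr0_norm// ler_pM2l//.
  have := ler_normB (p j) pm; have := p1 j jm; lra.
exists m, lam, x', sigma; split => //.
- by rewrite sg0.
- under eq_bigr do rewrite scalerDr; rewrite big_split /= -zx.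
  suff -> : \sum_(j < m) lam j *: (sigma *: (p j - pm)) = 0 by rewrite addr0.
  under eq_bigr do rewrite scalerA mulrC -scalerA.
  rewrite -scaler_sumr; under eq_bigr do rewrite scalerBr.
  by rewrite sumrB -/pm -scaler_suml lam1 scale1r subrr scaler0.
- move=> j jm; have [xn xF _] := xP j jm; have := x'x j jm => x'xj; split.
    have := ler_normD (x' j - x j) (x j); rewrite subrK; lra.
  by apply: near xF; lra.
- move=> i u iN uC; have [f [ff fE fp]] := pF _ _ u (GC i iN) C0 uC.
  exists f; split => //; first by move=> e eE; rewrite fE// mem_cat eE.
  move=> j jm; have fl := ff.1; have [_ _ /(_ i iN)] := xP j jm.
  rewrite (linD _ _ fl) (linZ _ _ fl) (linB _ _ fl) fp// /pm (lin_sum _ _ _ fl).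
  have -> : \sum_(l < m) lam l * f (p l) = \sum_(l < m) lam l * u l.
    by apply: eq_bigr => l _; rewrite fp.
  rewrite fE; last first.
    rewrite mem_cat; apply/orP; right; apply/mapP; exists j => //.
    by rewrite mem_iota.
  by rewrite opprD addrACA subrr addr0.
Qed.

End Flexibility.

(** * Finite stages of the construction *)

Section Tree.
Context {R : realType} {Y : normedModType R}.
Implicit Types (f g h : Y -> R) (B C d : R).

(** A generator together with its side: Some true and Some false for a generator
    of the first or the second body only, None for a generator of both. *)
Definition node := (Y * option bool)%type.
Implicit Types (L M : seq node) (cs : seq R).

(** Two nodes are rivals when some body has both among its generators. *)
Definition rival (a b : option bool) :=
  if (a, b) is (Some x, Some y) then x == y else true.

Definition nd L i : node := nth (0, None) L i.
Definition points L : seq Y := [seq n.1 | n <- L].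

(** The bound 8 on the norms below is uniform over the whole construction: small
    vectors can then be added at any time without spoiling the separation. *)
Definition separated_by B c L i f :=
  [/\ functional B f, f (nd L i).1 = 1 & forall j, (j < size L)%N -> j != i ->
    rival (nd L i).2 (nd L j).2 -> `|f (nd L j).1| < 1 - c].

Definition separated c L i := exists B f, B < 8 /\ separated_by B c L i f.

(** The list cs holds the separation constants of the nodes processed so far.
    The others are separated with constant nth 0 cs i = 0, that is, just
    strictly. All conditions are open, so finitely many nodes always leave some
    room for the next perturbation. *)
Definition admissible L cs :=
  [/\ (forall n, n \in L -> `|n.1| < 2),
      (forall n, n \in L -> n.2 = None -> `|n.1| <= 5 / 16),
      (forall c, c \in cs -> 0 < c /\ c <= 1 / 2),
      (size cs <= size L)%N &
      forall i, (i < size L)%N -> separated (nth 0 cs i) L i].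

Lemma points_nd L i : (i < size L)%N -> (nd L i).1 \in points L.
Proof. by move=> iL; apply/mapP; exists (nd L i) => //; exact: mem_nth. Qed.

Lemma separated_ext B c L M i f : (i < size L)%N -> B < 8 ->
  separated_by B c L i f ->
  (forall m, m \in M -> rival (nd L i).2 m.2 -> `|f m.1| < 1 - c) ->
  separated c (L ++ M) i.
Proof.
move=> iL B8 [ff fi fj] fM; exists B, f; split => //.
have ndi : nd (L ++ M) i = nd L i by rewrite /nd nth_cat iL.
split => //; rewrite ndi // => j; rewrite size_cat => jL ji.
rewrite /nd nth_cat; case: ltnP => jL'; first exact: fj.
by apply: fM; apply: mem_nth; rewrite ltn_subLR.
Qed.

Lemma separated_new B L M k f : (k < size M)%N -> B < 8 -> functional B f ->
  f (nd M k).1 = 1 ->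
  (forall n, n \in L -> rival (nd M k).2 n.2 -> `|f n.1| < 1) ->
  (forall l, (l < size M)%N -> l != k -> rival (nd M k).2 (nd M l).2 ->
    `|f (nd M l).1| < 1) ->
  separated 0 (L ++ M) (size L + k)%N.
Proof.
move=> kM B8 ff fk fL fM; exists B, f; split => //.
have ndk : nd (L ++ M) (size L + k) = nd M k.
  by rewrite /nd nth_cat ltnNge leq_addr /= addKn.
split => //; rewrite ndk // => j; rewrite size_cat subr0 => jL jk.
rewrite /nd nth_cat; case: ltnP => jL'; first by apply: fL; exact: mem_nth.
apply: fM; first by rewrite ltn_subLR.
by apply: contra jk => /eqP <-; rewrite subnKC.
Qed.

Lemma admissible_cat L M cs cs' : admissible L cs ->
  (forall c, c \in cs' -> 0 < c /\ c <= 1 / 2) -> (size cs' <= size L)%N ->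
  (forall m, m \in M -> `|m.1| < 2 /\ (m.2 = None -> `|m.1| <= 5 / 16)) ->
  (forall i, (i < size L)%N -> separated (nth 0 cs' i) (L ++ M) i) ->
  (forall k, (k < size M)%N -> separated 0 (L ++ M) (size L + k)) ->
  admissible (L ++ M) cs'.
Proof.
move=> [L2 LN _ _ _] cs'1 cs's M2 sL sM; split => //.
- by move=> n; rewrite mem_cat => /orP[/L2//|/M2[]].
- by move=> n; rewrite mem_cat => /orP[/LN//|/M2[]].
- by rewrite size_cat (leq_trans cs's)// leq_addr.
- move=> i; rewrite size_cat => iLM; have [iL|iL] := ltnP i (size L); first exact: sL.
  rewrite -(subnKC iL) nth_default.
    by apply: sM; rewrite ltn_subLR.
  by rewrite subnKC// (leq_trans cs's).
Qed.

Lemma slack n (P : nat -> bool) (F : nat -> R) :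
  (forall j, (j < n)%N -> P j -> F j < 1) ->
  exists c, [/\ 0 < c, c <= 1 / 2 & forall j, (j < n)%N -> P j -> F j < 1 - c].
Proof.
elim: n => [|n IH] H; first by exists (1 / 2); split => //; lra.
have [|c [c0 c2 Hc]] := IH; first by move=> j jn; apply: H; exact: ltnW.
have [Pn|Pn] := boolP (P n); last first.
  exists c; split => // j; rewrite ltnS leq_eqVlt => /predU1P[->|]; last exact: Hc.
  by rewrite (negPf Pn).
have Fn := H n (ltnSn n) Pn.
exists (Num.min c ((1 - F n) / 2)); split.
- by rewrite lt_min c0 divr_gt0//; lra.
- by rewrite ge_min c2.
- move=> j; rewrite ltnS leq_eqVlt => /predU1P[->|jn] Pj.
    have : Num.min c ((1 - F n) / 2) <= (1 - F n) / 2 by rewrite ge_min lexx orbT.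
    lra.
  apply: lt_le_trans (Hc j jn Pj) _; rewrite lerD2l lerN2.
  by rewrite ge_min lexx.
Qed.

Lemma common_bound L cs : admissible L cs -> exists B (F : nat -> Y -> R),
  [/\ 4 <= B, B < 8 &
    forall i, (i < size L)%N -> separated_by B (nth 0 cs i) L i (F i)].
Proof.
move=> [_ _ _ _ sL].
have /choice[W HW] : forall i, exists W : R * (Y -> R), (i < size L)%N ->
    W.1 < 8 /\ separated_by W.1 (nth 0 cs i) L i W.2.
  move=> i; case: (ltnP i (size L)) => [/sL[B [f Bf]]|_].
    by exists (B, f).
  by exists (0, fun=> 0).
have [B [B4 B8 WB]] : exists B, [/\ 4 <= B, B < 8 &
    forall i, (i < size L)%N -> (W i).1 <= B].
  elim: (size L) HW => [|n IH] HW; first by exists 4; split => //; lra.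
  have [|B [B4 B8 WB]] := IH; first by move=> i ni; apply: HW; exact: ltnW.
  exists (Num.max B (W n).1); split.
  - by rewrite le_max B4.
  - by rewrite gt_max B8 (HW n _).1.
  - move=> i; rewrite ltnS leq_eqVlt => /predU1P[->|/WB iB].
      by rewrite le_max lexx orbT.
    by rewrite le_max iB.
exists B, (fun i => (W i).2); split => // i iL.
have [_ [Wf Wi Wj]] := HW i iL; split => //.
by apply: functional_le Wf; exact: WB.
Qed.

Hypothesis Yn0 : exists y : Y, y != 0.
Hypothesis daug : daugavet_property Y.

Lemma margin B : B < 8 -> 4 <= B -> exists d,
  [/\ 0 < d, d <= 1 / 8, (1 + d) * 4 < 8 & (1 + d) * B <= B + (8 - B) / 4].
Proof.
move=> B8 B4; exists ((8 - B) / 32); split; try lra.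
have : 0 <= (8 - B) * (8 - B) by rewrite mulr_ge0//; lra.
by lra.
Qed.

(** Both vectors y + q and y - q are generators of both bodies, which puts y in
    both. The vector q is free, and a functional with a small positive value at y
    tells y + q from q - y, the opposite of the other new generator. Since y is
    small, the value of an older functional at y stays below 1/2. *)
Lemma add_small_pair L cs y : admissible L cs -> y != 0 -> `|y| <= 1 / 16 ->
  exists q, admissible (L ++ [:: (y + q, None); (y - q, None)]) cs.
Proof.
move=> Lcs y0 y16; have [B [F [B4 B8 FL]]] := common_bound Lcs.
have [L2 LN cs2 csL _] := Lcs.
have [d [d0 d8 d4 dB]] := margin B8 B4.
have [p [p1 pF]] := free_exists Yn0 daug (y :: points L) d0.
pose q := (1 / 4) *: p.
have q4 : `|q| <= 1 / 4 by rewrite normrZ ger0_norm; lra.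
have yq5 : `|y + q| <= 5 / 16 /\ `|y - q| <= 5 / 16.
  by have := ler_normD y q; have := ler_normB y q; lra.
have ny : 0 < `|y| by rewrite normr_gt0.
exists q; apply: (admissible_cat Lcs) => //.
- by move=> m; rewrite !inE => /orP[] /eqP -> /=; split; lra.
- move=> i iL; have [ff fi fj] := FL i iL.
  have [|f [f'f fE fp]] := pF _ _ 0 ff; first by rewrite normr0; lra.
  have fq : f q = 0 by rewrite (linZ _ _ f'f.1) fp mulr0.
  have fL j : (j < size L)%N -> f (nd L j).1 = F i (nd L j).1.
    by move=> jL; rewrite fE// in_cons points_nd// orbT.
  have c2 : nth 0 cs i <= 1 / 2.
    have [ics|ics] := ltnP i (size cs); first by have [] := cs2 _ (mem_nth 0 ics).
    by rewrite nth_default//; lra.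
  have fy : `|f y| < 1 - nth 0 cs i.
    rewrite fE ?mem_head//; apply: le_lt_trans (ff.2 y) _.
    have : B * `|y| <= B * (1 / 16) by rewrite ler_pM2l//; lra.
    lra.
  apply: (separated_ext iL (B := (1 + d) * B) (f := f)); first lra.
    by split; rewrite ?fL// => j jL; rewrite fL//; exact: fj.
  by move=> m; rewrite !inE => /orP[] /eqP -> _ /=;
    rewrite ?(linB _ _ f'f.1) ?(linD _ _ f'f.1) fq ?subr0 ?addr0.
- have [g [gf gy]] := norming y.
  have g4 := functional_scale (1 / 4) gf.
  rewrite ger0_norm in g4; last lra.
  have gC : functional 4 (fun x => 1 / 4 * g x).
    by apply: functional_le g4; lra.
  have key (s : R) : `|s| <= 1 -> exists f, [/\ functional ((1 + d) * 4) f,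
      forall n, n \in L -> `|f n.1| < 1, f y = `|y| / 4 & f q = s * (1 - `|y| / 4)].
    move=> s1; have [|f [ff fE fp]] := pF _ _ (4 * s * (1 - `|y| / 4)) gC.
      rewrite !normrM ger0_norm; last lra.
      rewrite [`|1 - _|]ger0_norm; last lra.
      have := normr_ge0 s; nra.
    exists f; split => //.
    - move=> n nL; rewrite fE; last by rewrite in_cons map_f ?orbT.
      apply: le_lt_trans (g4.2 _) _; have := L2 n nL; lra.
    - by rewrite fE ?mem_head// gy; lra.
    - by rewrite (linZ _ _ ff.1) fp; lra.
  have [|f1 [f1f f1L f1y f1q]] := key 1; first by rewrite normr1.
  have [|f2 [f2f f2L f2y f2q]] := key (-1); first by rewrite normrN1.
  move=> [|[|//]] _.
    apply: (separated_new _ d4 f1f) => //=.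
    + by rewrite (linD _ _ f1f.1) f1y f1q; lra.
    + by move=> n nL _; exact: f1L.
    + move=> [|[|//]] //= _ _ _; rewrite (linB _ _ f1f.1) f1y f1q.
      by rewrite ltr_norml; lra.
  apply: (separated_new _ d4 f2f) => //=.
  + by rewrite (linB _ _ f2f.1) f2y f2q; lra.
  + by move=> n nL _; exact: f2L.
  + move=> [|[|//]] //= _ _ _; rewrite (linD _ _ f2f.1) f2y f2q.
    by rewrite ltr_norml; lra.
Qed.

Lemma tilted_values (e : R) : 0 < e -> e <= 1 / 16 ->
  [/\ 0 < (1 - 4 * e) / (1 - e), (1 - 4 * e) / (1 - e) < 1 &
    1 < (1 + 4 * e) / (1 - e)].
Proof.
move=> e0 e16; have e1 : 0 < 1 - e by lra.
by split; rewrite ?divr_gt0 ?ltr_pdivrMr ?ltr_pdivlMr//; lra.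
Qed.

(** The node z has to be a convex combination of later nodes although some
    functional f with f z = 1 must stay below 1 on all later nodes of the same
    side. A node v on the other side resolves the conflict: v is free over the
    past, so f v = 4 can be prescribed, and z = e v + (1 - e) z' then forces
    f z' < 1. Prescribing f v = - 4 instead gives f z' > 1 and hence, after
    scaling, a functional that separates z' from all its rivals, z included.
    For the functionals of the rivals of z, f v = f z keeps f z' = f z. *)
Lemma add_opposite L cs z b d0 : admissible L cs -> (size cs < size L)%N ->
  nd L (size cs) = (z, Some b) -> 0 < d0 ->
  exists v z' e c, [/\ 0 < e < 1, z = e *: v + (1 - e) *: z',
    free_over (points L) d0 v &
    admissible (L ++ [:: (v, Some (~~ b)); (z', Some b)]) (rcons cs c)].
Proof.
move=> Lcs kL; set k := size cs in kL * => kz d00.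
have [B [F [B4 B8 FL]]] := common_bound Lcs.
have [L2 LN cs2 csL _] := Lcs.
have [d1 [d10 d18 d14 d1B]] := margin B8 B4.
pose d := Num.min d0 d1.
have d_0 : 0 < d by rewrite lt_min d00.
have [dd0 dd1] : d <= d0 /\ d <= d1 by rewrite !ge_min !lexx orbT.
have d4 : (1 + d) * 4 < 8 by lra.
have dB : (1 + d) * B < 8.
  have : (1 + d) * B <= (1 + d1) * B by rewrite ler_wpM2r//; lra.
  lra.
have [v [v1 vF]] := free_exists Yn0 daug (points L) d_0.
have z2 : `|z| < 2 by have := L2 _ (mem_nth (0, None) kL); rewrite -/(nd L k) kz.
pose e := Num.min (1 / 16) ((2 - `|z|) / 8).
have e0 : 0 < e by rewrite lt_min divr_gt0//=; lra.
have [e16 ez] : e <= 1 / 16 /\ e <= (2 - `|z|) / 8.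
  by rewrite /e !ge_min !lexx orbT.
have e1 : 0 < 1 - e by lra.
pose z' := (1 - e)^-1 *: (z - e *: v).
have zE : z = e *: v + (1 - e) *: z'.
  by rewrite scalerA mulfV ?gt_eqF// scale1r addrCA subrr addr0.
have z'2 : `|z'| < 2.
  rewrite normrZ normfV (gtr0_norm e1) mulrC ltr_pdivrMr//.
  apply: le_lt_trans (ler_normB _ _) _; rewrite normrZ (gtr0_norm e0).
  have : e * `|v| <= e by rewrite ler_piMr// ltW.
  lra.
have fz' f : lin f -> f z' = (f z - e * f v) / (1 - e).
  by move=> fl; rewrite (linZ _ _ fl) (linB _ _ fl) (linZ _ _ fl) mulrC.
have ptL f' f : (forall x, x \in points L -> f' x = f x) ->
    forall j, (j < size L)%N -> f' (nd L j).1 = f (nd L j).1.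
  by move=> H j jL; rewrite H// points_nd.
have [Fkf Fk1 Fkj] := FL k kL.
have Fkz : F k z = 1 by rewrite -Fk1 kz.
have [|f1 [f1f f1E f1v]] := vF _ _ 4 Fkf; first by rewrite ger0_norm.
have [|f2 [f2f f2E f2v]] := vF _ _ (- 4) Fkf; first by rewrite normrN ger0_norm.
have zL : z \in points L by rewrite -[z]/((z, Some b).1) -kz points_nd.
have f1z' : f1 z' = (1 - 4 * e) / (1 - e) by rewrite (fz' _ f1f.1) (f1E _ zL) Fkz f1v [e * 4]mulrC.
have f2z' : f2 z' = (1 + 4 * e) / (1 - e).
  by rewrite (fz' _ f2f.1) (f2E _ zL) Fkz f2v mulrN opprK [e * 4]mulrC.
have [f1z0 f1z1 f2z1] := tilted_values e0 e16.
rewrite -f1z' in f1z0 f1z1; rewrite -f2z' in f2z1.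
have f2z0 : 0 < f2 z' by exact: lt_trans f2z1.
clear f1z' f2z'.
have [c1 [c10 c12 Hc1]] := @slack (size L)
  (fun j => (j != k) && rival (nd L k).2 (nd L j).2)
  (fun j => `|F k (nd L j).1|) (ltac:(move=> j jL /andP[jk jr];
    apply: (lt_le_trans (Fkj j jL jk jr)); rewrite nth_default// subr0//)).
pose c := Num.min c1 ((1 - f1 z') / 2).
have c0 : 0 < c by rewrite lt_min c10 divr_gt0// subr_gt0.
have [cc1 cc2] : c <= c1 /\ c <= (1 - f1 z') / 2 by rewrite !ge_min !lexx orbT.
exists v, z', e, c; split => //; first by rewrite e0 -subr_gt0.
  exact: free_le vF.
apply: (admissible_cat Lcs).
- move=> c'; rewrite mem_rcons in_cons => /predU1P[->|]; last exact: cs2.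
  by split => //; exact: le_trans c12.
- by rewrite size_rcons.
- move=> m; rewrite !inE => /orP[] /eqP -> /=; split => //.
  by apply: le_lt_trans v1 _; rewrite ltr1n.
- move=> i iL; have [ik|ik] := eqVneq i k.
    rewrite ik nth_rcons ltnn eqxx.
    apply: (separated_ext kL (B := (1 + d) * B) (f := f1)) => //.
      split => //; first by rewrite (ptL _ _ f1E).
      move=> j jL jk jr; rewrite (ptL _ _ f1E)//.
      by apply: lt_le_trans (Hc1 j jL _) _; [rewrite jk|rewrite lerD2l lerN2].
    move=> m; rewrite !inE kz => /orP[] /eqP -> /=.
      by rewrite /rival; case: (b).
    by rewrite gtr0_norm//; clear -cc2 c0; lra.
  have -> : nth 0 (rcons cs c) i = nth 0 cs i.
    rewrite nth_rcons; case: ltnP => // ki; rewrite (negPf ik).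
    by rewrite nth_default.
  have [ff fi fj] := FL i iL.
  have [ir|ir] := boolP (rival (nd L i).2 (Some b)).
    have fz : `|F i z| < 1 - nth 0 cs i.
      by have := fj k kL; rewrite kz /=; apply => //; rewrite eq_sym.
    have c'0 : 0 <= nth 0 cs i.
      have [ics|ics] := ltnP i (size cs); last by rewrite nth_default.
      by have [/ltW] := cs2 _ (mem_nth 0 ics).
    have [|f [f'f fE fv]] := vF _ _ (F i z) ff; first by clear -fz c'0 B4; lra.
    apply: (separated_ext iL (B := (1 + d) * B) (f := f)) => //.
      by split; rewrite ?(ptL _ _ fE)// => j jL; rewrite (ptL _ _ fE)//; exact: fj.
    move=> m; rewrite !inE => /orP[] /eqP -> _ /=; first by rewrite fv.
    rewrite (fz' _ f'f.1) fE// fv.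
    have -> : F i z - e * F i z = F i z * (1 - e) by ring.
    by rewrite mulfK ?gt_eqF.
  have [|f [f'f fE fv]] := vF _ _ 0 ff; first by rewrite normr0; clear -B4; lra.
  apply: (separated_ext iL (B := (1 + d) * B) (f := f)) => //.
    by split; rewrite ?(ptL _ _ fE)// => j jL; rewrite (ptL _ _ fE)//; exact: fj.
  move=> m; rewrite !inE => /orP[] /eqP -> /=; last by rewrite (negPf ir).
  rewrite fv normr0; have [ics|ics] := ltnP i (size cs); last by rewrite nth_default// subr0.
  by have [_] := cs2 _ (mem_nth 0 ics); clear; lra.
- move=> [|[|//]] _.
    have z4 : (0 : R) <= 4 by [].
    have [|f [ff fE fv]] := vF _ _ 1 (functional0 z4); first by rewrite normr1 ler1n.
    apply: (separated_new _ d4 ff) => //=.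
      by move=> n nL _; rewrite fE ?normr0// map_f.
    by move=> [|[|//]] //= _ _; rewrite /rival; case: (b).
  have r1 : `|(f2 z')^-1| * ((1 + d) * B) < 8.
    rewrite normfV (gtr0_norm f2z0) mulrC ltr_pdivrMr//.
    by clear -dB f2z1; lra.
  apply: (separated_new _ r1 (functional_scale _ f2f)) => //=.
  + by rewrite mulVf// gt_eqF.
  + move=> n /(nthP (0, None))[j jL <-]; rewrite -/(nd L j) => jr.
    rewrite (ptL _ _ f2E)// normrM normfV (gtr0_norm f2z0) mulrC ltr_pdivrMr// mul1r.
    have [->|jk] := eqVneq j k; first by rewrite Fk1 normr1.
    apply: lt_trans f2z1; have := Fkj j jL jk; rewrite kz => /(_ jr).
    by rewrite nth_default// subr0.
  + by move=> [|[|//]] //= _ _; rewrite /rival; case: (b).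
Qed.

(** The last node z is present only virtually and is replaced by the points of a
    spread decomposition of z. These are so close to z for the separating
    functionals that the other nodes remain separated, and the functional of z,
    pushed up at one of the points and down at the others, separates them from
    each other. *)
Lemma split_last L cs z b d0 : admissible (rcons L (z, Some b)) cs ->
  (size cs <= size L)%N -> 0 < d0 ->
  exists M, admissible (L ++ M) cs /\
    forall phi (al : R), lin phi -> al < phi z -> exists m,
      [/\ m \in M, m.2 = Some b, free_over (points L) d0 m.1 & al < phi m.1].
Proof.
move=> Lcs csL d00; have [B [F [B4 B8 FL]]] := common_bound Lcs.
have [L2 LN cs2 _ _] := Lcs.
have [d [d_0 _ _ dB]] := margin B8 B4.
set n := size L.
have ndL j : (j < n)%N -> nd (rcons L (z, Some b)) j = nd L j.
  by move=> jn; rewrite /nd nth_rcons jn.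
have ndn : nd (rcons L (z, Some b)) n = (z, Some b).
  by rewrite /nd nth_rcons ltnn eqxx.
have {FL} FL i : (i <= n)%N ->
    separated_by B (nth 0 cs i) (rcons L (z, Some b)) i (F i).
  by move=> iL; apply: FL; rewrite size_rcons ltnS.
have csn : nth 0 cs n = 0 by rewrite nth_default.
have [gf gz gj] := FL n (leqnn n); rewrite csn subr0 ndn in gj.
rewrite ndn /= in gz.
have z2 : `|z| < 2 by apply: (L2 (z, Some b)); rewrite mem_rcons mem_head.
have {LN} LcsL : admissible L cs.
  split => //.
  - by move=> k kL; apply: L2; rewrite mem_rcons in_cons kL orbT.
  - by move=> k kL; apply: LN; rewrite mem_rcons in_cons kL orbT.
  - move=> i iL; exists B, (F i); split => //.
    have [ff fi fj] := FL i (ltnW iL); rewrite ndL// in fi fj; split => // j jL ji.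
    by have := fj j; rewrite ndL// size_rcons ltnS => /(_ (ltnW jL) ji).
have {L2 cs2} [s1 [s10 _ Hs1]] : exists c, [/\ 0 < c, c <= 1 / 2 & forall j, (j < n)%N ->
    rival (nd L j).2 (Some b) -> `|F j z| + nth 0 cs j < 1 - c].
  apply: (slack (F := fun j => `|F j z| + nth 0 cs j)
    (P := fun j => rival (nd L j).2 (Some b))) => j jn jr.
  have [_ _ /(_ n)] := FL j (ltnW jn); rewrite size_rcons ltnSn ndL// ndn /=.
  by rewrite neq_ltn jn orbT => /(_ isT isT jr); rewrite ltrBrDr.
have [s2 [s20 s22 Hs2]] : exists c, [/\ 0 < c, c <= 1 / 2 & forall j, (j < n)%N ->
    rival (Some b) (nd L j).2 -> `|F n (nd L j).1| < 1 - c].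
  apply: (slack (F := fun j => `|F n (nd L j).1|)
    (P := fun j => rival (Some b) (nd L j).2)) => j jn jr.
  have := gj j; rewrite size_rcons ltnS ltnW// neq_ltn jn ndL//.
  by move=> /(_ isT isT jr).
pose rho := Num.max 1 `|z|.
have rho1 : 1 <= rho by rewrite le_max lexx.
have zrho : `|z| <= rho by rewrite le_max lexx orbT.
have rho2 : rho < 2 by rewrite gt_max z2 andbT ltr1n.
pose tau := Num.min (Num.min s1 s2) (Num.min (2 - rho) (8 - B)) / 4.
have tau0 : 0 < tau by rewrite divr_gt0// !lt_min s10 s20 !subr_gt0 rho2.
have [t1 [t2 [t3 t4]]] : tau * 4 <= s1 /\ (tau * 4 <= s2 /\
    (tau * 4 <= 2 - rho /\ tau * 4 <= 8 - B)).
  by rewrite /tau divfK// !ge_min !lexx ?orbT.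
have FC i : (i < n.+1)%N -> functional B (F i) by move=> /FL[].
have B0 : 0 <= B by exact: le_trans B4.
have [m [lam [x [s [/andP[s0 st] [lam0 lam1] zx xP fP]]]]] :=
  spread_decomposition Yn0 daug (points L) FC B0 d00 d_0 rho1 zrho tau0.
pose M : seq node := [seq (x j, Some b) | j <- iota 0 m].
have Mm : size M = m by rewrite size_map size_iota.
have ndM j : (j < m)%N -> nd M j = (x j, Some b).
  by move=> jm; rewrite /nd (nth_map 0%N) ?size_iota// nth_iota.
have inM k : k \in M -> exists2 j, (j < m)%N & k = (x j, Some b).
  by move=> /mapP[j]; rewrite mem_iota add0n => /= jm ->; exists j.
have ptL f i : (forall e, e \in points L -> f e = F i e) ->
    forall j, (j < n)%N -> f (nd L j).1 = F i (nd L j).1.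
  by move=> fE j jn; rewrite fE// points_nd.
exists M; split; last first.
  move=> phi al phil alz; apply: contrapT => no.
  have xal j : (j < m)%N -> phi (x j) <= al.
    move=> jm; rewrite leNgt; apply/negP => h; apply: no.
    exists (x j, Some b); split => //; last by have [] := xP j jm.
    by apply/mapP; exists j => //; rewrite mem_iota.
  move: alz; rewrite ltNge => /negP; apply.
  rewrite zx (lin_sum _ _ _ phil) -[leRHS]mul1r -lam1 mulr_suml.
  by apply: ler_sum => j _; rewrite ler_wpM2l// ?lam0// xal.
apply: (admissible_cat LcsL) => //; first by case: LcsL.
- move=> k /inM[j jm ->] /=; split => //; have [xn _] := xP j jm.
  by apply: le_lt_trans xn _; clear -st t3 tau0; lra.
- move=> i iL; have [_ fi fj] := FL i (ltnW iL).
  have [|f [ff fE fx]] := fP i (fun=> 0) (leqW iL).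
    by move=> j _; rewrite normr0.
  rewrite ndL// in fi fj.
  apply: (separated_ext iL (B := (1 + d) * B) (f := f)).
  + by clear -dB B8; lra.
  + split => //; first by rewrite (ptL _ _ fE).
    move=> j jL ji; rewrite (ptL _ _ fE)//; have := fj j.
    by rewrite ndL// size_rcons ltnS; apply => //; exact: ltnW.
  + move=> k /inM[j jm ->] /= ir; have := fx j jm.
    under eq_bigr do rewrite mulr0.
    rewrite big1// subrr mulr0 addr0 => fxj.
    have := ler_normD (f (x j) - F i z) (F i z); rewrite subrK.
    by have := Hs1 i iL ir; clear -fxj st t1 tau0; lra.
rewrite Mm => k km.
have [|g [g'f gE gx]] := fP n (fun i => (i == k)%:R) (ltnSn n).
  by move=> j _; case: (j == k); rewrite ?normr1 ?normr0//; clear -B4; lra.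
have sumk : \sum_(i < m) lam i * (i == k :> nat)%:R = lam k.
  rewrite (bigD1 (Ordinal km)) //= eqxx mulr1 big1 ?addr0// => i ik.
  by rewrite -val_eqE /= in ik; rewrite (negPf ik) mulr0.
rewrite sumk gz in gx.
have lamk1 : lam k <= 1.
  rewrite -lam1 (bigD1 (Ordinal km)) //= lerDl sumr_ge0// => i _; exact: lam0.
have lamt : s * lam k <= s by rewrite ler_piMr// ltW.
have lamt0 : 0 <= s * lam k by rewrite mulr_ge0 ?lam0// ltW.
have gk : 1 - s / 4 + s - s * lam k < g (x k).
  have := gx k km; rewrite eqxx /= ltr_norml => /andP[h _].
  by clear -h; lra.
have A0 : 0 < g (x k) by clear -gk lamt s0 st t2 s22; lra.
have r1 : `|(g (x k))^-1| * ((1 + d) * B) < 8.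
  rewrite normfV (gtr0_norm A0) mulrC ltr_pdivrMr//.
  by clear -gk lamt st t4 dB B8; lra.
apply: (separated_new _ r1 (functional_scale _ g'f)); rewrite ?Mm//.
- by rewrite ndM//= mulVf// gt_eqF.
- move=> q /(nthP (0, None))[j jL <-]; rewrite -/(nd L j) ndM//= => jr.
  rewrite (ptL _ _ gE)// normrM normfV (gtr0_norm A0) mulrC ltr_pdivrMr// mul1r.
  by have := Hs2 j jL jr; clear -gk lamt s0 st t2; lra.
- move=> l lm lk _; rewrite !ndM//= normrM normfV (gtr0_norm A0) mulrC.
  rewrite ltr_pdivrMr// mul1r ltr_norml.
  have := gx l lm; rewrite (negPf lk) /= ltr_norml => /andP[h1 h2].
  by clear -h1 h2 gk lamt lamt0 s0 st t2 s22; lra.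
Qed.

End Tree.

(** * Closed convex hulls and slices *)

Section ClosedHull.
Context {R : realType} {Y : normedModType R}.
Implicit Types (X S K : set Y) (f : Y -> R).

Lemma closure_normP S k : closure S k <->
  forall e : R, 0 < e -> exists2 s, S s & `|k - s| < e.
Proof.
split=> [h e e0|h B /nbhs_normP[e /= e0 eB]].
  have [s [Ss]] := h _ (nbhsx_ballx k e e0).
  by rewrite -ball_normE /=; exists s.
by have [s Ss ks] := h e e0; exists s; split => //; exact: eB.
Qed.

Lemma cvx_closure S : cvx S -> cvx (closure S).
Proof.
move=> Sc x y t t0 t1 /closure_normP xS /closure_normP yS; apply/closure_normP => e e0.
have [x' Sx' xx'] := xS e e0; have [y' Sy' yy'] := yS e e0.
exists (t *: x' + (1 - t) *: y'); first exact: Sc.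
rewrite opprD addrACA -!scalerBr; apply: le_lt_trans (ler_normD _ _) _.
rewrite !normrZ !ger0_norm ?subr_ge0//.
have [->|tn0] := eqVneq t 0; first lra.
have tp : 0 < t by rewrite lt_neqAle eq_sym tn0.
have h1 : t * `|x - x'| < t * e by rewrite ltr_pM2l.
have h2 : (1 - t) * `|y - y'| <= (1 - t) * e by rewrite ler_wpM2l ?subr_ge0// ltW.
lra.
Qed.

Definition closed_hull X := closure (convex_hull X).

Lemma sub_closed_hull X : X `<=` closed_hull X.
Proof. by apply: subset_trans (@subset_closure _ _); exact: sub_gen_smallest. Qed.

Lemma cvx_convex_hull X : cvx (convex_hull X).
Proof.
move=> x y t t0 t1 hx hy M MX; have [/cvx_convex_set Mc _] := MX.
by apply: Mc => //; [exact: hx M MX|exact: hy M MX].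
Qed.

Lemma cvx_closed_hull X : cvx (closed_hull X).
Proof. by apply: cvx_closure; exact: cvx_convex_hull. Qed.

Lemma convex_hull_min X S : cvx S -> X `<=` S -> convex_hull X `<=` S.
Proof. by move=> /cvx_convex_set Sc XS; exact: smallest_sub. Qed.

Lemma closed_hull_min X S : cvx S -> closure S `<=` S -> X `<=` S ->
  closed_hull X `<=` S.
Proof.
move=> Sc Scl XS; apply: subset_trans Scl; apply: closureS.
exact: convex_hull_min.
Qed.

Lemma closed_hull_sub X X' : X `<=` closed_hull X' -> closed_hull X `<=` closed_hull X'.
Proof.
apply: closed_hull_min; first exact: cvx_closed_hull.
have /closure_id <- : closed (closed_hull X') by exact: closed_closure.
exact: subset_refl.
Qed.

Lemma closed_hull_symmetric X : (forall x, X x -> X (- x)) ->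
  symmetric_set (closed_hull X).
Proof.
move=> Xs; have sub : closed_hull X `<=` [set k | closed_hull X (- k)].
  apply: closed_hull_min.
  - move=> x y t t0 t1 hx hy /=; rewrite opprD -!scalerN.
    exact: cvx_closed_hull.
  - move=> k /closure_normP hk /=.
    have /closure_id -> : closed (closed_hull X) by exact: closed_closure.
    apply/closure_normP => e e0; have [s hs ks] := hk e e0.
    by exists (- s) => //; rewrite -opprD normrN.
  - by move=> x Xx; apply: sub_closed_hull; exact: Xs.
apply/seteqP; split => [_ [x hx <-]|x hx]; first exact: sub.
by exists (- x); [exact: sub|rewrite opprK].
Qed.

Lemma closed_hull_norm X (r : R) : (forall x, X x -> `|x| <= r) ->
  forall k, closed_hull X k -> `|k| <= r.
Proof.
move=> Xr; apply: closed_hull_min => //.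
- move=> x y t t0 t1 /= xr yr; apply: le_trans (ler_normD _ _) _.
  rewrite !normrZ !ger0_norm ?subr_ge0//.
  have t10 : 0 <= 1 - t by lra.
  by have := ler_wpM2l t0 xr; have := ler_wpM2l t10 yr; lra.
- move=> k /closure_normP hk /=; apply/ler_addgt0Pr => e e0.
  have [s sr ks] := hk e e0; have := ler_normD (k - s) s; rewrite subrK /= in sr *.
  lra.
Qed.

Lemma bounded_setP X (r : R) : (forall x, X x -> `|x| <= r) -> bounded_set X.
Proof.
move=> Xr; exists r; split; first exact: num_real.
by move=> M rM x Xx; apply: le_trans (Xr x Xx) (ltW rM).
Qed.

Lemma closed_hull_le X C f (a : R) : functional C f ->
  (forall x, X x -> f x <= a) -> forall k, closed_hull X k -> f k <= a.
Proof.
move=> ff Xa; apply: closed_hull_min => //.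
- move=> x y t t0 t1 /= hx hy; rewrite (linD _ _ ff.1) !(linZ _ _ ff.1).
  have t10 : 0 <= 1 - t by lra.
  by have := ler_wpM2l t0 hx; have := ler_wpM2l t10 hy; lra.
- move=> k /closure_normP hk /=; apply/ler_addgt0Pr => e e0.
  have e'0 : 0 < e / (1 + `|C|) by rewrite divr_gt0// ltr_pwDl.
  have [s /= hs] := hk _ e'0; rewrite ltr_pdivlMr ?ltr_pwDl// => ks.
  have := ff.2 (k - s); rewrite (linB _ _ ff.1) => fks.
  have : C * `|k - s| <= `|C| * `|k - s| by rewrite ler_wpM2r// ler_norm.
  have := ler_norm (f k - f s); have := normr_ge0 (k - s); lra.
Qed.

(** The inequality is convex and closed in k and holds at the points of X, so
    it holds on the closed convex hull: slices of f near u have small diameter. *)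
Lemma closed_hull_exposed X C (r d : R) f u : functional C f -> 0 < d ->
  (forall x, X x -> `|x| <= r) -> X u ->
  (forall x, X x -> x != u -> f x + d <= f u) ->
  forall k, closed_hull X k -> `|k - u| <= 2 * r / d * (f u - f k).
Proof.
move=> ff d0 Xr Xu fu; have fl := ff.1.
have r0 : 0 <= r by exact: le_trans (Xr _ Xu).
set A := 2 * r / d.
have A0 : 0 <= A by rewrite divr_ge0 ?mulr_ge0// ltW.
apply: closed_hull_min.
- move=> x y t t0 t1 /= hx hy.
  have -> : t *: x + (1 - t) *: y - u = t *: (x - u) + (1 - t) *: (y - u).
    rewrite !scalerBr addrACA -opprD -scalerDl.
    by rewrite addrCA subrr addr0 scale1r.
  apply: le_trans (ler_normD _ _) _.
  rewrite (linD _ _ fl) !(linZ _ _ fl) !normrZ !ger0_norm ?subr_ge0//.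
  have t10 : 0 <= 1 - t by lra.
  by have := ler_wpM2l t0 hx; have := ler_wpM2l t10 hy; lra.
- move=> k /closure_normP hk /=; apply/ler_addgt0Pr => e e0.
  have C0 : 0 <= A * `|C| by exact: mulr_ge0.
  have e'0 : 0 < e / (1 + A * `|C|) by rewrite divr_gt0//; lra.
  have [s /= hs] := hk _ e'0; rewrite ltr_pdivlMr; last lra.
  move=> ks.
  have fks : A * (f s - f k) >= - (A * `|C| * `|k - s|).
    have : f k - f s <= `|C| * `|k - s|.
      rewrite -(linB _ _ fl); have /andP[_] := functional_bound (k - s) ff.
      by move=> /le_trans; apply; rewrite ler_wpM2r// ler_norm.
    by move=> /(ler_wpM2l A0); lra.
  have := ler_normD (k - s) (s - u); rewrite addrA subrK; lra.
- move=> x Xx /=; have [->|xu] := eqVneq x u; first by rewrite !subrr normr0 mulr0.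
  have h := fu x Xx xu.
  have : `|x - u| <= 2 * r.
    by have := ler_normB x u; have := Xr x Xx; have := Xr u Xu; lra.
  have : A * d <= A * (f u - f x) by rewrite ler_wpM2l//; lra.
  by rewrite {1}/A divfK ?gt_eqF//; lra.
Qed.

Section lin_fun.
Variable f : Y -> R.
Hypothesis fl : lin f.
Let lin_fun (x : Y) : R^o := f x.
Let lin_fun_linear : linear lin_fun.
Proof. by move=> a x y; rewrite /lin_fun fl. Qed.
Definition linear_of : {linear Y -> R^o} := HB.pack lin_fun
  (GRing.isLinear.Build R Y R^o _ lin_fun lin_fun_linear).
End lin_fun.

Lemma functional_slice C f K (e : R) : functional C f -> (exists y, f y != 0) ->
  0 < e -> is_slice K (slice K f e).
Proof.
move=> ff fn0 e0; exists (linear_of ff.1), e; split => //.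
exact: (@lin_continuous _ _ _ (linear_of ff.1) C ff.2).
Qed.

(** The slices of diameter tending to 0 around the points of X determine the
    hull: a set that meets all of them has every point of X in its closure. *)
Lemma SCD_closed_hull X (r : R) (u : nat -> Y) :
  (forall x, X x -> `|x| <= r) -> (forall n, X (u n)) ->
  (forall x, X x -> exists n, u n = x) ->
  (forall x, X x -> exists f C d, [/\ functional C f, 0 < d, 0 < f x &
    forall x', X x' -> x' != x -> f x' + d <= f x]) ->
  SCD (closed_hull X).
Proof.
move=> Xr Xu uX sepX; split.
  by apply: (@bounded_setP _ r); exact: closed_hull_norm.
set K := closed_hull X.
have /choice[F HF] : forall n, exists F : (Y -> R) * (R * R),
    [/\ functional F.2.1 F.1, 0 < F.2.2, 0 < F.1 (u n) &
    forall x', X x' -> x' != u n -> F.1 x' + F.2.2 <= F.1 (u n)].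
  by move=> n; have [f [C [d H]]] := sepX _ (Xu n); exists (f, (C, d)).
pose f n := (F n).1; pose A n := 2 * r / (F n).2.2.
have r0 : 0 <= r by exact: le_trans (Xr _ (Xu 0%N)).
have A0 n : 0 <= A n by case: (HF n) => _ d0 _ _; rewrite divr_ge0 ?mulr_ge0// ltW.
have key n k : K k -> `|k - u n| <= A n * (f n (u n) - f n k).
  by case: (HF n) => h1 h2 _ h3; exact: (closed_hull_exposed h1 h2 Xr (Xu n) h3).
have fle n k : K k -> f n k <= f n (u n).
  case: (HF n) => h1 h2 _ h3; apply: (closed_hull_le h1) => x Xx.
  have [->//|xu] := eqVneq x (u n).
  by have := h3 x Xx xu; rewrite -/(f n); lra.
have Ku n : K (u n) by apply: sub_closed_hull; exact: Xu.
have supf n : sup [set f n a | a in K] = f n (u n).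
  apply/eqP; rewrite eq_le; apply/andP; split.
    apply: ge_sup; first by exists (f n (u n)), (u n).
    by move=> _ [k Kk <-]; exact: fle.
  apply: ub_le_sup; last by exists (u n).
  by exists (f n (u n)) => _ [k Kk <-]; exact: fle.
pose nm k : nat * nat := odflt (0, 0)%N (unpickle k).
pose U k := slice K (f (nm k).1) ((nm k).2.+1%:R)^-1.
have i0 k : 0 < ((nm k).2.+1%:R : R)^-1 by rewrite invr_gt0 ltr0n.
exists U; split; last first.
  move=> k; case: (HF (nm k).1) => h1 h2 h0 h3.
  by apply: (functional_slice _ h1) => //; exists (u (nm k).1); rewrite gt_eqF.
split.
  move=> k; split; last by move=> x [].
  exists (u (nm k).1); split => //; rewrite supf.
  by rewrite ltrBlDr ltrDl; exact: i0.
move=> B BU; apply: closed_hull_sub => x /uX[n <-].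
apply/closure_normP => e e0.
have [m me] : exists m, A n * (m.+1%:R)^-1 < e.
  exists (Num.truncn (A n / e)); rewrite ltr_pdivrMr ?ltr0n// mulrC.
  rewrite -ltr_pdivrMr//.
  by have /andP[] := truncn_itv (divr_ge0 (A0 n) (ltW e0)).
have := BU (pickle (n, m)); rewrite /U /nm pickleK /= => -[b [Bb [Kb]]].
rewrite supf => fb; exists b; first exact: sub_gen_smallest.
rewrite distrC; apply: le_lt_trans (key n b Kb) _.
apply: le_lt_trans me; rewrite ler_wpM2l// lerBlDr [leRHS]addrC -lerBlDr.
exact: ltW.
Qed.

End ClosedHull.

(** * The infinite construction *)

Section Construction.
Context {R : realType} {Y : normedModType R}.
Hypothesis Yn0 : exists y : Y, y != 0.
Hypothesis daug : daugavet_property Y.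
Implicit Types (L M : seq (@node R Y)) (cs : seq R).

Definition hides L d M (z : Y) := forall phi (al : R), lin phi -> al < phi z ->
  exists m, [/\ m \in M, m.2 != None, free_over (points L) d m.1 & al < phi m.1].

Lemma process_node L cs d : admissible L cs -> (size cs < size L)%N -> 0 < d ->
  exists M c, admissible (L ++ M) (rcons cs c) /\
    ((nd L (size cs)).2 != None -> hides L d M (nd L (size cs)).1).
Proof.
move=> Lcs kL d0; case E : (nd L (size cs)) => [z [b|]] /=.
  have [v [z' [e [c [/andP[e0 e1] zE vF]]]]] := add_opposite Yn0 daug Lcs kL E d0.
  rewrite -cat_rcons cats1 => adm.
  have [|M [adm' MP]] := split_last Yn0 daug adm _ d0.
    by rewrite !size_rcons ltnW// ltnS.
  exists ((v, Some (~~ b)) :: M), c; split; first by rewrite -cat_rcons.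
  move=> _ phi al phil; rewrite zE (linD _ _ phil) !(linZ _ _ phil) => alz.
  have [alv|alv] := ltP al (phi v).
    by exists (v, Some (~~ b)); split => //; rewrite mem_head.
  have alz' : al < phi z'.
    rewrite ltNge; apply/negP => h.
    have := ler_wpM2l (ltW e0) alv; have : (1 - e) * phi z' <= (1 - e) * al.
      by rewrite ler_wpM2l// subr_ge0 ltW.
    lra.
  have [m [mM m2 mF alm]] := MP phi al phil alz'.
  exists m; split => //; first by rewrite in_cons mM orbT.
    by rewrite m2.
  apply: free_subset mF => x xL; rewrite /points map_rcons mem_rcons in_cons.
  by rewrite xL orbT.
have [L2 LN cs2 csL sL] := Lcs.
have [B [f [B8 [ff fk fj]]]] := sL _ kL.
have [c [c0 c2 Hc]] := @slack R (size L)
  (fun j => (j != size cs) && rival (nd L (size cs)).2 (nd L j).2)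
  (fun j => `|f (nd L j).1|) (ltac:(move=> j jL /andP[jk jr];
    apply: (lt_le_trans (fj j jL jk jr)); rewrite nth_default// subr0//)).
exists [::], c; split => //; rewrite cats0; split => //.
- move=> c'; rewrite mem_rcons in_cons => /predU1P[->//|]; exact: cs2.
- by rewrite size_rcons.
- move=> i iL; rewrite nth_rcons; case: ltngtP => ik.
  + exact: sL.
  + by have := sL i iL; rewrite [nth 0 cs i]nth_default// ltnW.
  + rewrite ik; exists B, f; split => //; split => // j jL jk jr.
    by apply: Hc => //; rewrite jk.
Qed.

Lemma tree_step L cs d y : admissible L cs -> (size cs < size L)%N -> 0 < d ->
    y != 0 -> `|y| <= 1 / 16 ->
  exists M c q, [/\ admissible (L ++ M) (rcons cs c),
    (nd L (size cs)).2 != None -> hides L d M (nd L (size cs)).1,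
    (y + q, None) \in M & (y - q, None) \in M].
Proof.
move=> Lcs kL d0 y0 y16; have [M [c [adm hid]]] := process_node Lcs kL d0.
have [q adm'] := add_small_pair Yn0 daug adm y0 y16.
exists (M ++ [:: (y + q, None); (y - q, None)]), c, q; split.
- by rewrite catA.
- move=> kN phi al phil alz; have [m [mM m2 mF alm]] := hid kN phi al phil alz.
  by exists m; split => //; rewrite mem_cat mM.
- by rewrite mem_cat !inE eqxx orbT.
- by rewrite mem_cat !inE eqxx !orbT.
Qed.

(** Small enough for the product of all the factors 1 + delta n to be at most 2. *)
Definition delta (n : nat) : R := 2^-1 ^+ n.+2.

Lemma delta_gt0 n : 0 < delta n.
Proof. by rewrite exprn_gt0// invr_gt0. Qed.

Lemma delta_le m n : (m <= n)%N -> delta n <= delta m.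
Proof.
by move=> mn; rewrite ler_wiXn2l ?invr_ge0// ?invf_le1// ?ler1n//; lra.
Qed.

(** The functionals may vary with the stage K; a single one is extracted later by
    separation. *)
Definition isolated (N : nat -> @node R Y) i := exists c, 0 < c /\
  forall K, exists f, [/\ functional 8 f, f (N i).1 = 1 &
    forall j, (j <= K)%N -> j != i -> rival (N i).2 (N j).2 ->
      `|f (N j).1| < 1 - c].

(** The opposite of being denting: every slice containing the node contains a
    later one, free over the past. *)
Definition hidden (N : nat -> @node R Y) i := forall phi (al : R), lin phi ->
  al < phi (N i).1 -> exists j, [/\ (i < j)%N, (N j).2 != None,
    al < phi (N j).1 &
    free_over [seq (N l).1 | l <- iota 0 i.+1] (delta i) (N j).1].

(** Stage k processes the k-th node, so that every node is processed eventually
    and only its descendants come later. *)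
Lemma tree_exists (y : nat -> Y) (z0 : Y) : `|z0| = 1 ->
  (forall k, y k != 0 /\ `|y k| <= 1 / 16) -> exists N : nat -> @node R Y,
  [/\ N 0%N = (z0, Some true),
      forall i, `|(N i).1| <= 2 /\ ((N i).2 = None -> `|(N i).1| <= 5 / 16),
      forall i, isolated N i,
      forall i, (N i).2 != None -> hidden N i &
      forall k, exists i j q, N i = (y k + q, None) /\ N j = (y k - q, None)].
Proof.
move=> z01 yP; pose state : Type := (seq (@node R Y) * seq R)%type.
pose good (s : state) := admissible s.1 s.2 /\ (size s.2 < size s.1)%N.
pose next k (s s' : state) := exists M c q, [/\ s' = (s.1 ++ M, rcons s.2 c),
    (nd s.1 (size s.2)).2 != None ->
      hides s.1 (delta (size s.2)) M (nd s.1 (size s.2)).1,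
    (y k + q, None) \in M & (y k - q, None) \in M].
have /choice[T HT] : forall ks : nat * state, exists s', good ks.2 ->
    good s' /\ next ks.1 ks.2 s'.
  move=> [k [L cs]]; have [[Lcs kL]|ng] := pselect (good (L, cs)); last first.
    by exists (L, cs) => /ng.
  have [y0 y16] := yP k.
  have [M [c [q [adm hid q1 q2]]]] := tree_step Lcs kL (delta_gt0 (size cs)) y0 y16.
  exists (L ++ M, rcons cs c) => _; split; last by exists M, c, q.
  split => //=; rewrite size_cat size_rcons.
  have M1 : (0 < size M)%N by case: (M) q1.
  by apply: leq_trans (leq_add kL M1); rewrite addn1.
pose St := fix St k : state := if k is k'.+1 then T (k', St k')
  else ([:: (z0, Some true)], [::]).
have St0 : good (St 0%N).
  split => //; split => //=.
  - by move=> n; rewrite mem_seq1 => /eqP -> /=; rewrite z01; lra.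
  - by move=> n; rewrite mem_seq1 => /eqP ->.
  - move=> [|//] _; have [f [ff fz]] := norming z0.
    exists 1, f; split; first by lra.
    split => //=; first by rewrite fz z01.
    by move=> [|j].
have Stg k : good (St k).
  elim: k => // k IH; exact: (HT (k, St k) IH).1.
have Stn k : next k (St k) (St k.+1) by exact: (HT (k, St k) (Stg k)).2.
have St0E : St 0%N = ([:: (z0, Some true)], [::]) by [].
have Stc0 : size (St 0%N).2 = 0%N by [].
clearbody St.
have Stc k : size (St k).2 = k.
  elim: k => [//|k IH]; have [M [c [q [-> _ _ _]]]] := Stn k.
  by rewrite /= size_rcons IH.
have Stl k : (k < size (St k).1)%N by have [_] := Stg k; rewrite Stc.
have Stp k m j : (k <= m)%N -> (j < size (St k).1)%N ->
    (j < size (St m).1)%N /\ nd (St m).1 j = nd (St k).1 j.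
  elim: m => [|m IH]; first by rewrite leqn0 => /eqP -> jk; split.
  rewrite leq_eqVlt => /predU1P[-> jk|]; first by split.
  rewrite ltnS => km jk; have [IH1 IH2] := IH km jk.
  have [M [c [q [-> _ _ _]]]] := Stn m.
  by rewrite /= size_cat ltn_addr//; split => //; rewrite /nd nth_cat IH1.
pose N n := nd (St n).1 n.
have ndN k j : (j < size (St k).1)%N -> nd (St k).1 j = N j.
  move=> jk; have [le|/ltnW le] := leqP j k.
    by have [_ ->] := Stp j k j le (Stl j).
  by have [_ <-] := Stp k j j le jk.
have inN k n : n \in (St k).1 -> exists2 i, (i < size (St k).1)%N & n = N i.
  by move=> /(nthP (0, None))[i ik <-]; exists i => //; rewrite -(ndN k).
have newN k M n c : St k.+1 = ((St k).1 ++ M, c) -> n \in M ->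
    exists2 i, (k < i)%N & n = N i.
  move=> e /(nthP (0, None))[i iM <-]; exists (size (St k).1 + i)%N.
    by rewrite (leq_trans (Stl k))// leq_addr.
  rewrite -(ndN k.+1) e /= ?size_cat ?ltn_add2l//.
  by rewrite /nd nth_cat ltnNge leq_addr /= addKn.
exists N; split.
- by rewrite /N St0E.
- move=> i; have [[L2 LN _ _ _] _] := Stg i.
  have iL : N i \in (St i).1 by exact: mem_nth.
  by split; [exact: ltW (L2 _ iL)|exact: LN].
- move=> i; pose c := nth 0 (St i.+1).2 i.
  have cE k : nth 0 (St (i.+1 + k)%N).2 i = c.
    elim: k => [|k IH]; first by rewrite addn0.
    rewrite addnS; have [M [c' [q [-> _ _ _]]]] := Stn (i.+1 + k)%N.
    by rewrite /= nth_rcons Stc ltnS leq_addr.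
  have c0 : 0 < c.
    have [[_ _ c2 _ _] _] := Stg i.+1.
    by have [] := c2 c (mem_nth 0 _); rewrite ?Stc.
  exists c; split => // K; pose k := (i.+1 + K)%N.
  have [[_ _ _ _ sep] _] := Stg k.
  have ik : (i < size (St k).1)%N.
    by apply: leq_ltn_trans (Stl k); rewrite /k addSn (leq_trans (leq_addr K i)).
  have [B [f [B8 [ff fi fj]]]] := sep i ik.
  rewrite cE ndN// in fi fj; exists f; split => //.
    exact: functional_le (ltW B8) ff.
  move=> j jK ji jr; have jk : (j < size (St k).1)%N.
    by apply: leq_ltn_trans (Stl k); rewrite (leq_trans jK)// /k leq_addl.
  by have := fj j jk; rewrite ndN//; apply.
- move=> i iN phi al phil ali.
  have [M [c [q [e hid _ _]]]] := Stn i; rewrite Stc -/(N i) in hid.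
  have [m [mM mN mF alm]] := hid iN phi al phil ali.
  have [j ij mE] := newN _ _ _ _ e mM.
  exists j; rewrite -mE; split => //; apply: free_subset mF.
  move=> x /mapP[l]; rewrite mem_iota add0n /= ltnS => li ->.
  have lS : (l < size (St i).1)%N by exact: leq_ltn_trans (Stl i).
  by rewrite -(ndN i)//; exact: points_nd.
- move=> k; have [M [c [q [e _ q1 q2]]]] := Stn k.
  have [i _ iE] := newN _ _ _ _ e q1; have [j _ jE] := newN _ _ _ _ e q2.
  by exists i, j, q.
Qed.

End Construction.

(** * The two bodies *)

Section Pair.
Context {R : realType} {Y : normedModType R}.
Hypothesis Yn0 : exists y : Y, y != 0.
Hypothesis daug : daugavet_property Y.

Definition side_points (N : nat -> @node R Y) b := [set x | exists i,
  (N i).2 != Some (~~ b) /\ (x = (N i).1 \/ x = - (N i).1)].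

Lemma side_pointsN N b x : side_points N b x -> side_points N b (- x).
Proof.
move=> [i [iN [->|->]]]; exists i; split => //; [by right|left].
by rewrite opprK.
Qed.

Lemma rival_side a a' b : a != Some (~~ b) -> a' != Some (~~ b) -> rival a a'.
Proof. by case: a a' b => [[]|] [[]|] []. Qed.

(** Points of a convex hull involve finitely many generators only, so a sequence
    of functionals that are eventually good at each generator gives a convex set
    containing the hull. This replaces a limit of the functionals. *)
Lemma cvx_eventually_le (good : nat -> (Y -> R) -> Prop) (r : R) :
  (forall n f, good n f -> lin f) ->
  cvx [set k | exists n0, forall n f, (n0 <= n)%N -> good n f -> f k <= r].
Proof.
move=> gl x y t t0 t1 [m hm] [n hn]; exists (maxn m n) => k f.
rewrite geq_max => /andP[mk nk] gf; have fl := gl _ _ gf.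
rewrite (linD _ _ fl) !(linZ _ _ fl).
have t10 : 0 <= 1 - t by lra.
have := ler_wpM2l t0 (hm k f mk gf); have := ler_wpM2l t10 (hn k f nk gf); lra.
Qed.

Lemma exposed_side_point N b i : (N i).2 != Some (~~ b) -> isolated N i ->
  exists f d, [/\ functional 1 f, 0 < d, 0 < f (N i).1 &
    forall x, side_points N b x -> x != (N i).1 -> f x + d <= f (N i).1].
Proof.
move=> iN [c [c0 HK]]; set u := (N i).1.
pose good K f := [/\ functional 8 f, f u = 1 & forall j, (j <= K)%N -> j != i ->
  rival (N i).2 (N j).2 -> `|f (N j).1| < 1 - c].
set X := [set x | side_points N b x /\ x != u].
have XQ : convex_hull X `<=` [set k | exists n0, forall n f, (n0 <= n)%N ->
    good n f -> f k <= Num.max (1 - c) (- 1)].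
  apply: convex_hull_min; first by apply: cvx_eventually_le => n f [[]].
  move=> x [[j [jN xE]] xu]; exists j => n f jn [ff fu fj].
  rewrite le_max; have [ji|ji] := eqVneq j i.
    move: xE xu; rewrite ji => -[->|->]; first by rewrite eqxx.
    by rewrite (linN _ ff.1) fu lexx orbT.
  have := fj j jn ji (rival_side iN jN); rewrite ltr_norml => /andP[h1 h2].
  by apply/orP; left; case: xE => ->; rewrite ?(linN _ ff.1); lra.
pose c' := Num.min c 2.
have c'0 : 0 < c' by rewrite lt_min c0; lra.
have c'E : 1 - Num.max (1 - c) (- 1) = c'.
  by rewrite /c'; case: (lerP c 2) => h; case: (lerP (1 - c) (- 1)) => h'; lra.
have [|f [ff fX]] := separation (u := u) (d := c' / 8) (@cvx_convex_hull R Y X).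
  move=> k /XQ[n hn]; have [g gg] := HK n.
  have gk := hn n g (leqnn n) gg; case: gg => gf gu _.
  have : g (u - k) <= 8 * `|u - k| by have /andP[] := functional_bound (u - k) gf.
  rewrite (linB _ _ gf.1) gu; lra.
have {}fX x : side_points N b x -> x != u -> f x + c' / 8 <= f u.
  by move=> Xx xu; apply: fX; exact: sub_gen_smallest.
have fu0 : 0 < f u.
  have [g [gf gu _]] := HK 0%N.
  have Nu : - u != u.
    by apply/eqP => /(congr1 g); rewrite (linN _ gf.1) gu; lra.
  have /fX/(_ Nu) : side_points N b (- u) by exists i; split => //; right.
  rewrite (linN _ ff.1); lra.
by exists f, (c' / 8); split => //; rewrite divr_gt0.
Qed.

Lemma SCD_side N b i0 : (forall i, `|(N i).1| <= 2) -> (N i0).2 = None ->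
  (forall i, isolated N i) ->
  SCD (closed_hull (side_points N b)).
Proof.
move=> N2 Ni0 sep.
(* n codes the vector N n./2 with the sign given by the parity of n *)
pose u n := if (N n./2).2 != Some (~~ b) then
  (if odd n then - (N n./2).1 else (N n./2).1) else (N i0).1.
apply: (@SCD_closed_hull _ _ _ 2 u).
- by move=> x [i [_ [->|->]]]; rewrite ?normrN.
- move=> n; rewrite /u; case: ifPn => h.
    by exists n./2; split => //; case: (odd n); [right|left].
  by exists i0; rewrite Ni0; split => //; left.
- move=> x [i [iN [->|->]]].
    by exists i.*2; rewrite /u doubleK iN odd_double.
  by exists i.*2.+1; rewrite /u /= uphalf_double iN odd_double.
- have pos i : (N i).2 != Some (~~ b) -> exists f d,
      [/\ functional 1 f, 0 < d, 0 < f (N i).1 &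
      forall x, side_points N b x -> x != (N i).1 -> f x + d <= f (N i).1].
    by move=> iN; exact: exposed_side_point.
  move=> x [i [iN xE]]; have [f [d [ff d0 f0 fX]]] := pos i iN.
  case: xE => ->; first by exists f, 1, d.
  exists (fun y => - 1 * f y), (`|- 1| * 1), d; split => //.
  + exact: functional_scale.
  + by rewrite (linN _ ff.1); lra.
  + move=> x' Xx' x'N; have := fX _ (side_pointsN Xx').
    rewrite eqr_oppLR => /(_ x'N); rewrite !(linN _ ff.1); lra.
Qed.

(** Iterating the property of being hidden leads beyond any given stage. *)
Lemma deep_free (N : nat -> @node R Y) K j phi (al : R) :
  (forall i, (N i).2 != None -> hidden N i) ->
  lin phi -> (N j).2 != None -> al < phi (N j).1 ->
  exists i, [/\ (N i).2 != None, al < phi (N i).1 &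
    free_over [seq (N l).1 | l <- iota 0 K.+1] (@delta R K) (N i).1].
Proof.
move=> step phil; have [n] := ubnP (K - j).
elim: n j => // n IH j; rewrite ltnS => Kjn jN jal.
have [i [ji iN ial iF]] := step j jN phi al phil jal.
have [Kj|jK] := leqP K j.
  exists i; split => //; apply: free_le (delta_le Kj) _; apply: free_subset iF.
  move=> x /mapP[l]; rewrite mem_iota add0n => /andP[_ lK] ->; apply/mapP.
  by exists l => //; rewrite mem_iota add0n (leq_trans lK).
by apply: (IH i) => //; apply: leq_trans Kjn; apply: ltn_sub2l.
Qed.

Lemma continuous_functional (xs : {linear Y -> R^o}) : continuous xs ->
  exists C, @functional R Y C xs.
Proof.
move=> /linear_bounded_continuous/linear_boundedP.
move=> /pinfty_ex_gt0[C C0 HC]; exists C; split => //.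
by move=> a x y; rewrite linearP.
Qed.

Lemma slice_generator (X : set Y) C f (al : R) a : functional C f ->
  closed_hull X a -> al < f a -> exists2 x, X x & al < f x.
Proof.
move=> ff Xa ala; apply: contrapT => no; move: ala; rewrite ltNge => /negP; apply.
apply: (closed_hull_le ff _ Xa) => x Xx; rewrite leNgt; apply/negP => h.
by apply: no; exists x.
Qed.

(** From the n-th slice pick x n, either small or free over z0 and the points
    picked before. Then functionals of norm at most 2 exist that are 1 at z0 and
    vanish at the free ones among x 0, ..., x n; at the small ones they are at
    most 2 * 5 / 16. Hence z0 is not in the closed convex hull of the x n. *)
Lemma union_not_SCD (N : nat -> @node R Y) z0 : `|z0| = 1 -> N 0%N = (z0, Some true) ->
  (forall i, (N i).2 = None -> `|(N i).1| <= 5 / 16) ->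
  (forall i, (N i).2 != None -> hidden N i) ->
  ~ SCD (closed_hull (side_points N true) `|` closed_hull (side_points N false)).
Proof.
move=> z01 N0 Nsmall step; set A := _ `|` _ => -[_ [U [[U0 Udet] Usl]]].
have AX b x : side_points N b x -> A x.
  by move=> /sub_closed_hull; case: b => h; [left|right].
have XA x i : x = (N i).1 \/ x = - (N i).1 -> A x.
  move=> xE; case E : (N i).2 => [b|]; last first.
    by apply: (AX true); exists i; rewrite E.
  by apply: (AX b); exists i; rewrite E; split => //; case: (b).
have sel n K : exists x i, [/\ U n x, x = (N i).1 \/ x = - (N i).1 &
    `|x| <= 5 / 16 \/
    free_over [seq (N l).1 | l <- iota 0 K.+1] (@delta R K) (N i).1].
  have [xs [eps [xsc _ eps0 UE]]] := Usl n.
  have [C xsf] := continuous_functional xsc.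
  have [[a]] := U0 n; rewrite UE => -[Aa ala] _.
  set al := _ - eps in ala.
  have [b [x Xx alx]] : exists b, exists2 x, side_points N b x & al < xs x.
    by case: Aa => Ba; [exists true|exists false]; exact: slice_generator xsf Ba ala.
  case: Xx => i [_ xE].
  have [iN|iN] := eqVneq (N i).2 None.
    exists x, i; split => //; first by split => //; exact: XA xE.
    by left; case: xE => ->; rewrite ?normrN Nsmall.
  pose s : R := if x == (N i).1 then 1 else - 1.
  have xs_i : x = s *: (N i).1.
    rewrite /s; case: eqP => [->|]; first by rewrite scale1r.
    by case: xE => // ->; rewrite scaleN1r.
  have sxl : lin (fun y => s * xs y) by exact: (functional_scale s xsf).1.
  have alx' : al < s * xs (N i).1 by move: alx; rewrite xs_i linearZ.
  have [j [jN jal jF]] := deep_free K step sxl iN alx'.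
  have sjE : s *: (N j).1 = (N j).1 \/ s *: (N j).1 = - (N j).1.
    by rewrite /s; case: ifP => _; [left; rewrite scale1r|right; rewrite scaleN1r].
  exists (s *: (N j).1), j; split => //; last by right.
  by split; [exact: XA sjE|rewrite linearZ].
have /choice[g Hg] : forall nK : nat * nat, exists xi : Y * nat,
    [/\ U nK.1 xi.1, xi.1 = (N xi.2).1 \/ xi.1 = - (N xi.2).1 &
    `|xi.1| <= 5 / 16 \/
    free_over [seq (N l).1 | l <- iota 0 nK.2.+1] (@delta R nK.2) (N xi.2).1].
  by move=> [n K]; have [x [i H]] := sel n K; exists (x, i).
(* Kf n exceeds all the indices of nodes picked before step n *)
pose Kf := fix Kf n := if n is n'.+1 then (Kf n' + (g (n', Kf n')).2).+1 else 0%N.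
pose x n := (g (n, Kf n)).1; pose ix n := (g (n, Kf n)).2.
have HgE n : [/\ U n (x n), x n = (N (ix n)).1 \/ x n = - (N (ix n)).1 &
    `|x n| <= 5 / 16 \/
    free_over [seq (N l).1 | l <- iota 0 (Kf n).+1] (@delta R (Kf n)) (N (ix n)).1].
  exact: Hg (n, Kf n).
have KfS n : Kf n.+1 = (Kf n + ix n).+1 by [].
have Kfn n : (n <= Kf n)%N.
  by elim: n => // n IH; rewrite KfS ltnS (leq_trans IH)// leq_addr.
have ixK m n : (m < n)%N -> (ix m <= Kf n)%N.
  elim: n => // n IH; rewrite ltnS leq_eqVlt KfS => /predU1P[->|/IH le].
    by rewrite ltnW// ltnS leq_addl.
  by rewrite (leq_trans le)// ltnW// ltnS leq_addr.
clearbody Kf.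
pose beta n : R := 2 - 2^-1 ^+ n.
have hn n : 0 < (2^-1 : R) ^+ n <= 1.
  by rewrite exprn_gt0 ?invr_gt0//= exprn_ile1 ?invr_ge0// invf_le1//; lra.
have beta2 n : beta n <= 2 by have /andP[] := hn n; rewrite /beta; lra.
pose good n (f : Y -> R) := [/\ functional 2 f, f z0 = 1 &
  forall m, (m < n)%N -> `|f (x m)| <= 5 / 8].
have goodE n : exists f, functional (beta n) f /\ good n f.
  elim: n => [|n [f [ff [f2 fz fm]]]].
    have [f [ff fz]] := norming z0; rewrite z01 in fz; exists f.
    rewrite /beta expr0; split; last split => //.
      by apply: functional_le ff; lra.
    by apply: functional_le ff; lra.
  have bb : beta n <= beta n.+1.
    by have /andP[h1 _] := hn n; rewrite /beta exprS; lra.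
  have [Un xE [xs|xF]] := HgE n.
    exists f; split; first exact: functional_le ff.
    split => // m; rewrite ltnS leq_eqVlt => /predU1P[->|/fm//].
    by apply: le_trans (f2.2 _) _; lra.
  have b0 : 0 <= beta n by have /andP[_ h2] := hn n; rewrite /beta; lra.
  have [|f' [f'f f'E f'x]] := xF f _ 0 ff; first by rewrite normr0.
  have f'b : functional (beta n.+1) f'.
    apply: functional_le f'f.
    have : (1 + delta (Kf n)) * beta n <= (1 + delta n) * beta n.
      by rewrite ler_wpM2r// lerD2l; exact: delta_le.
    move=> /le_trans; apply; rewrite /delta /beta !exprS.
    have /andP[h1 h2] := hn n; move: (_ ^+ n) h1 h2 => h h1 h2.
    by have := mulr_gt0 h1 h1; lra.
  have f'N l : (l <= Kf n)%N -> f' (N l).1 = f (N l).1.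
    by move=> lK; apply: f'E; apply/mapP; exists l => //; rewrite mem_iota add0n ltnS.
  exists f'; split => //; split.
  - exact: functional_le (beta2 _) f'b.
  - by have := f'N 0%N (leq0n _); rewrite N0 /= fz.
  - move=> m; rewrite ltnS leq_eqVlt => /predU1P[->|mn].
      have -> : f' (x n) = 0.
        by case: xE => ->; rewrite ?(linN _ f'f.1) f'x ?oppr0.
      by rewrite normr0; lra.
    have -> : f' (x m) = f (x m); last exact: fm.
    have [_ xmE _] := HgE m.
    by case: xmE => ->; rewrite ?(linN _ f'f.1) ?(linN _ ff.1) f'N// ixK.
have BQ : convex_hull (range x) `<=` [set k | exists n0, forall n f, (n0 <= n)%N ->
    good n f -> f k <= 5 / 8].
  apply: convex_hull_min; first by apply: cvx_eventually_le => n f [[]].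
  move=> _ [m _ <-]; exists m.+1 => n f mn [_ _ /(_ m mn)].
  exact/le_trans/ler_norm.
have Az0 : A z0 by apply: (XA _ 0%N); rewrite N0; left.
have /closure_normP cz : closure (convex_hull (range x)) z0.
  apply: (Udet (range x)) => // n.
  by exists (x n); split; [exists n|have [] := HgE n].
have e0 : 0 < (1 / 10 : R) by lra.
have [k /BQ[n hk] zk] := cz _ e0; have [f [_ gf]] := goodE n.
have fk := hk n f (leqnn n) gf; case: gf => ff fz _.
have /andP[_] := functional_bound (z0 - k) ff.
rewrite (linB _ _ ff.1) fz; lra.
Qed.

Lemma pair_exists (y : nat -> Y) : (forall k, y k != 0 /\ `|y k| <= 1 / 16) ->
  exists B1 B2 : set Y,
  [/\ [/\ convex_set B1, closed B1, bounded_set B1, symmetric_set B1 & SCD B1],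
     [/\ convex_set B2, closed B2, bounded_set B2, symmetric_set B2 & SCD B2],
     ~ SCD (B1 `|` B2) & forall k, B1 (y k) /\ B2 (y k)].
Proof.
move=> yP; have [z0 z01] := exists_norm Yn0 (@ler01 R).
have [N [N0 N2 sep step Ny]] := tree_exists Yn0 daug z01 yP.
have [i0 [_ [q [Ni0 _]]]] := Ny 0%N.
have body b : let B := closed_hull (side_points N b) in
    [/\ convex_set B, closed B, bounded_set B, symmetric_set B & SCD B] /\
    forall k, B (y k).
  split; first split.
  - apply/cvx_convex_set; exact: cvx_closed_hull.
  - exact: closed_closure.
  - apply: (@bounded_setP _ _ _ 2); apply: closed_hull_norm.
    by move=> x [i [_ [->|->]]]; rewrite ?normrN; case: (N2 i).
  - apply: closed_hull_symmetric; exact: side_pointsN.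
  - apply: (@SCD_side N b i0) => //; last by rewrite Ni0.
    by move=> i; case: (N2 i).
  move=> k; have [i [j [p [iE jE]]]] := Ny k.
  have -> : y k = (1 / 2) *: (y k + p) + (1 - 1 / 2) *: (y k - p).
    have -> : 1 - 1 / 2 = 1 / 2 :> R by lra.
    rewrite -scalerDr addrACA subrr addr0 scalerDr -scalerDl.
    have -> : 1 / 2 + 1 / 2 = 1 :> R by lra.
    by rewrite scale1r.
  apply: cvx_closed_hull; [lra|lra| |]; apply: sub_closed_hull.
    by exists i; rewrite iE; split => //; left.
  by exists j; rewrite jE; split => //; left.
have [B1P B1y] := body true; have [B2P B2y] := body false.
exists (closed_hull (side_points N true)), (closed_hull (side_points N false)).
split => //; apply: union_not_SCD z01 N0 _ step.
by move=> i; case: (N2 i).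
Qed.

(** Only nonzero vectors are required to be approximated; 0 is then a midpoint of
    two opposite points of B. *)
Lemma interior_of_dense (B : set Y) (r : R) : 0 < r -> convex_set B -> closed B ->
  symmetric_set B ->
  (forall w (e : R), w != 0 -> `|w| < r -> 0 < e -> exists2 b, B b & `|w - b| < e) ->
  B° !=set0.
Proof.
move=> r0 /cvx_convex_set Bc Bcl Bs Bd.
have Bw w : w != 0 -> `|w| < r -> B w.
  move=> w0 wr; rewrite (proj1 (closure_id _) Bcl); apply/closure_normP => e e0.
  exact: Bd.
exists 0; rewrite /interior; apply/nbhs_normP; exists r => // w.
rewrite /ball_ /= sub0r normrN => wr; have [->|w0] := eqVneq w 0; last exact: Bw.
have r20 : 0 <= r / 2 by lra.
have [w' w'n] := exists_norm Yn0 r20.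
have w'0 : w' != 0 by rewrite -normr_gt0 w'n divr_gt0.
have w'r : `|w'| < r by rewrite w'n; lra.
have -> : 0 = (1 / 2) *: w' + (1 - 1 / 2) *: (- w').
  have -> : 1 - 1 / 2 = 1 / 2 :> R by lra.
  by rewrite -scalerDr subrr scaler0.
apply: Bc; [lra|lra|exact: Bw|apply: Bw].
  by rewrite oppr_eq0.
by rewrite normrN.
Qed.

Lemma small_vector : exists v : Y, v != 0 /\ `|v| <= 1 / 16.
Proof.
have r0 : (0 : R) <= 1 / 16 by lra.
have [v vn] := exists_norm Yn0 r0; exists v; split; last by rewrite vn.
by rewrite -normr_gt0 vn; lra.
Qed.

(** The points of a countable dense set inside the small ball, 0 excepted; the
    remaining indices get the default value d0. *)
Lemma dense_sequence : separable_space Y -> exists y : nat -> Y,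
  (forall k, y k != 0 /\ `|y k| <= 1 / 16) /\
  forall w (e : R), w != 0 -> `|w| < 1 / 16 -> 0 < e ->
    exists k, `|w - y k| < e.
Proof.
move=> [D /countable_injP[f finj] Dd].
have [d0 [d00 d01]] := small_vector.
pose P n := [set x | [/\ D x, f x = n, x != 0 & `|x| <= 1 / 16]].
exists (fun n => xget d0 (P n)); split.
  by move=> k; case: xgetP => [x _ []|_].
move=> w e w0 w16 e0.
pose r := Num.min e (Num.min `|w| (1 / 16 - `|w|)).
have r0 : 0 < r by rewrite !lt_min e0 normr_gt0 w0 /=; lra.
have [r1 [r2 r3]] : r <= e /\ (r <= `|w| /\ r <= 1 / 16 - `|w|).
  by rewrite /r !ge_min !lexx ?orbT.
have bO : open (ball w r) by exact: ball_open.
have b0 : ball w r !=set0 by exists w; exact: ballxx.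
have [x [bx Dx]] := Dd _ b0 bO.
have wx : `|w - x| < r by move: bx; rewrite -ball_normE.
have Px : P (f x) x.
  split => //.
    apply/eqP => x0; move: wx; rewrite x0 subr0; lra.
  have := ler_normB w (w - x); rewrite subKr; lra.
exists (f x); case: xgetP => [x' x'E [Dx' fx' _ _]|/(_ _ Px)//].
have -> : x' = x by apply: finj => //; exact: mem_set.
lra.
Qed.

End Pair.

Theorem theorem3p4 (R : realType) (Y : completeNormedModType R) :
  (exists y : Y, y != 0) ->
  daugavet_property Y ->
  (exists B1 B2 : set Y,
     [/\ convex_set B1, closed B1, bounded_set B1, symmetric_set B1 & SCD B1] /\
     [/\ convex_set B2, closed B2, bounded_set B2, symmetric_set B2 & SCD B2] /\
     ~ SCD (B1 `|` B2)) /\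
  (separable_space Y ->
   exists B1 B2 : set Y,
     [/\ convex_set B1, closed B1, bounded_set B1, symmetric_set B1 & SCD B1] /\
     [/\ convex_set B2, closed B2, bounded_set B2, symmetric_set B2 & SCD B2] /\
     ~ SCD (B1 `|` B2) /\
     B1° !=set0 /\ B2° !=set0).
Proof.
move=> Yn0 daug; split.
  have [d0 [d00 d01]] := small_vector Yn0.
  have [B1 [B2 [B1P B2P nSCD _]]] := pair_exists Yn0 daug (y := fun=> d0)
    (fun=> conj d00 d01).
  by exists B1, B2.
move=> /(dense_sequence Yn0)[y [yP yd]].
have [B1 [B2 [B1P B2P nSCD By]]] := pair_exists Yn0 daug yP.
exists B1, B2; split => //; split => //; split => //.
have r0 : 0 < (1 / 16 : R) by lra.
by split; [case: B1P => ? ? _ ? _|case: B2P => ? ? _ ? _];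
  apply: (interior_of_dense Yn0 r0) => // w e w0 wr e0;
  have [k wk] := yd w e w0 wr e0; exists (y k) => //; case: (By k).
Qed.
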